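(* Let $\Bbbk$ be an algebraically closed field of characteristic $0$ and let $A=\mathrm M_n(\Bbbk)$ be the $\Bbbk$-algebra of $n\times n$-matrices with trace form $\beta(a,b)=\mathrm{tr}(ab)$. There are neither quasi-trigonometric nor trigonometric solutions of the $A$-CYBE.
   Context: Let $\gamma=\sum_ib_i^*\otimes b_i$ for bases $\{b_i\},\{b_i^*\}$ of $A$ with $\beta(b_i^*,b_j)=\delta_{ij}$. For $r\in(A\otimes A)[\![x,y]\!][(x-y)^{-1}]$ the $A$-CYBE is $$r^{13}(z_1,z_3)r^{12}(z_1,z_2)-r^{12}(z_1,z_2)r^{23}(z_2,z_3)+r^{23}(z_2,z_3)r^{13}(z_1,z_3)=0$$ in $(A\otimes A\otimes A)[\![z_1,z_2,z_3]\!][((z_1-z_2)(z_1-z_3)(z_2-z_3))^{-1}]$, where coefficientwise $t^{12}=t\otimes1$, $t^{23}=1\otimes t$, $(a\otimes b)^{13}=a\otimes1\otimes b$. Solutions $r_1,r_2$ are equivalent if $(\varphi(x)\otimes\varphi(y))r_1(u(x),u(y))=r_2(x,y)$ for some $\varphi\in\mathrm{Aut}_{\Bbbk[\![z]\!]\text{-alg}}(A[\![z]\!])$, $u\in z\Bbbk[\![z]\!]^\times$. A solution $r$ is quasi-trigonometric if it is equivalent to $\frac{y\gamma}{x-y}+t(x,y)$ for some $t\in(A\otimes A)[x,y]$. A solution $r$ is trigonometric if there exist a $\beta$-orthogonal $\sigma\in\mathrm{Aut}_{\Bbbk\text{-alg}}(A)$ of finite order $m$ and $s\in L(A,\sigma)\otimes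 L(A,\sigma)$ such that $r$ is equivalent to $$\frac{1}{\exp(x-y)-1}\sum_{j=0}^{m-1}\exp\left(\frac{j(x-y)}{m}\right)\gamma_j+s\left(\exp\left(\frac xm\right),\exp\left(\frac ym\right)\right),$$ where, for a primitive $m$-th root of unity $\varepsilon\in\Bbbk$, $\gamma_j\in A\otimes A$ is determined by $\gamma=\sum_{j=0}^{m-1}\gamma_j$, $(\sigma\otimes1)\gamma_j=\varepsilon^j\gamma_j$, and $L(A,\sigma)=\{a\in A[\widetilde v,\widetilde v^{-1}]\mid a(\varepsilon\widetilde v)=\sigma(a(\widetilde v))\}$. *)

(* Defs.v *)
From HB Require Import structures.
From mathcomp Require Import all_boot all_order all_algebra.
From mathcomp Require Import finmap.
From mathcomp Require Import mpoly boolp mxtens.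

Set Implicit Arguments.
Unset Strict Implicit.
Unset Printing Implicit Defensive.

Import Order.TTheory GRing.Theory.
Local Open Scope ring_scope.

Reserved Notation "{ 'series' T [ d ] }"
  (at level 0, T at level 2, d at level 2, format "{ 'series'  T [ d ] }").
Reserved Notation "{ 'sfrac' T [ d ] }"
  (at level 0, T at level 2, d at level 2, format "{ 'sfrac'  T [ d ] }").

Record series (d : nat) (R : Type) := Series { scoef : 'X_{1..d} -> R }.

Notation "{ 'series' T [ d ] }" := (series d T) : type_scope.

HB.instance Definition _ d R := gen_eqMixin (series d R).
HB.instance Definition _ d R := gen_choiceMixin (series d R).

Lemma seriesP d R (f g : {series R[d]}) : scoef f =1 scoef g -> f = g.
Proof. by case: f g => [f] [g] /= /funext ->. Qed.

Section SeriesZmodule.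
Variables (d : nat) (R : zmodType).
Implicit Types f g h : {series R[d]}.

Definition szero : {series R[d]} := Series (fun=> 0).
Definition sopp f : {series R[d]} := Series (fun m => - scoef f m).
Definition sadd f g : {series R[d]} := Series (fun m => scoef f m + scoef g m).

Lemma saddA : associative sadd.
Proof. by move=> f g h; apply: seriesP => m /=; rewrite addrA. Qed.
Lemma saddC : commutative sadd.
Proof. by move=> f g; apply: seriesP => m /=; rewrite addrC. Qed.
Lemma sadd0 : left_id szero sadd.
Proof. by move=> f; apply: seriesP => m /=; rewrite add0r. Qed.
Lemma saddN : left_inverse szero sopp sadd.
Proof. by move=> f; apply: seriesP => m /=; rewrite addNr. Qed.

HB.instance Definition _ :=
  GRing.isZmodule.Build {series R[d]} saddA saddC sadd0 saddN.

End SeriesZmodule.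

Section SeriesRing.
Variables (d : nat) (R : comNzRingType).
Implicit Types (f g h : {series R[d]}) (m : 'X_{1..d}).

Definition sconst (c : R) : {series R[d]} :=
  Series (fun m => if m == 0%MM then c else 0).

Definition smul f g : {series R[d]} := Series (fun m =>
  \sum_(k : 'X_{1..d < (mdeg m).+1, (mdeg m).+1} | m == (k.1 + k.2)%MM)
     scoef f k.1 * scoef g k.2).

(* The ring axioms are transferred from {mpoly R[d]}: a coefficient of a
   product of series is a coefficient of the product of large truncations. *)
Definition strunc D f : {mpoly R[d]} :=
  \sum_(k : 'X_{1..d < D}) scoef f k *: 'X_[k].

Lemma strunc_coef D f m : (mdeg m < D)%N -> (strunc D f)@_m = scoef f m.
Proof.
move=> ltmD; rewrite /strunc raddf_sum /= (bigD1 (BMultinom ltmD)) //=.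
rewrite mcoeffZ mcoeffX eqxx mulr1 big1 ?addr0 // => k nek.
rewrite mcoeffZ mcoeffX; case: eqP => [ekm|]; last by rewrite mulr0.
by case/eqP: nek; apply: val_inj.
Qed.

Lemma mulm_coefE (p q : {mpoly R[d]}) f g m :
    (forall k, (mdeg k <= mdeg m)%N -> p@_k = scoef f k) ->
    (forall k, (mdeg k <= mdeg m)%N -> q@_k = scoef g k) ->
  (p * q)@_m = scoef (smul f g) m.
Proof.
move=> Ep Eq; rewrite mcoeffM; apply: eq_bigr => -[k1 k2] _ /=.
by rewrite Ep ?Eq // -ltnS bmdeg.
Qed.

Lemma smul_trunc D f g m : (mdeg m < D)%N ->
  scoef (smul f g) m = (strunc D f * strunc D g)@_m.
Proof.
move=> ltmD; apply/esym/mulm_coefE => k lekm;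
  by rewrite strunc_coef // (leq_ltn_trans lekm).
Qed.

Lemma smulA : associative smul.
Proof.
move=> f g h; apply: seriesP => m; have lt_m := ltnSn (mdeg m).
rewrite -(@mulm_coefE (strunc (mdeg m).+1 f)
  (strunc (mdeg m).+1 g * strunc (mdeg m).+1 h)); first 1 last.
- by move=> k le_km; rewrite strunc_coef.
- by move=> k le_km; rewrite -smul_trunc.
rewrite mulrA; apply: mulm_coefE => k le_km; last by rewrite strunc_coef.
by rewrite -smul_trunc.
Qed.

Lemma smulC : commutative smul.
Proof.
move=> f g; apply: seriesP => m.
by rewrite !(smul_trunc _ _ (ltnSn _)) mulrC.
Qed.

Lemma smul1 : left_id (sconst 1) smul.
Proof.
move=> f; apply: seriesP => m; rewrite -(@mulm_coefE 1 (strunc (mdeg m).+1 f)).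
- by rewrite mul1r strunc_coef.
- by move=> k _; rewrite mcoeff1 /=; case: eqP.
- by move=> k le_km; rewrite strunc_coef.
Qed.

Lemma smulDl : left_distributive smul +%R.
Proof.
move=> f g h; apply: seriesP => m /=; rewrite -big_split /=.
by apply: eq_bigr => k _; rewrite mulrDl.
Qed.

Lemma sone_neq0 : sconst 1 != 0.
Proof.
apply/eqP => /(congr1 (fun f => scoef f 0%MM)) /= /eqP.
by rewrite eqxx oner_eq0.
Qed.

HB.instance Definition _ := GRing.Zmodule_isComNzRing.Build {series R[d]}
  smulA smulC smul1 smulDl sone_neq0.

Lemma scoefM f g m : scoef (f * g) m =
  \sum_(k : 'X_{1..d < (mdeg m).+1, (mdeg m).+1} | m == (k.1 + k.2)%MM)
     scoef f k.1 * scoef g k.2.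
Proof. by []. Qed.

Definition sunit : {pred {series R[d]}} := fun f => `[< exists g, g * f = 1 >].

Definition sinv f : {series R[d]} :=
  if pselect (exists g, g * f = 1) is left ex then projT1 (cid ex) else f.

Lemma smulVf : {in sunit, left_inverse 1 sinv *%R}.
Proof.
move=> f; rewrite /in_mem /= => /asboolP exf; rewrite /sinv.
by case: pselect => // ex; case: cid.
Qed.
Lemma sunitPl f g : g * f = 1 -> sunit f.
Proof. by move=> fg1; apply/asboolP; exists g. Qed.
Lemma sinv_out : {in [predC sunit], sinv =1 id}.
Proof.
move=> f; rewrite inE /= => /asboolPn nexf; rewrite /sinv.
by case: pselect.
Qed.

HB.instance Definition _ := GRing.ComNzRing_hasMulInverse.Build {series R[d]}
  smulVf sunitPl sinv_out.

Definition svar (i : 'I_d) : {series R[d]} :=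
  Series (fun m => (m == U_(i)%MM)%:R).

Definition series_of_mpoly (p : {mpoly R[d]}) : {series R[d]} :=
  Series (fun m => p@_m).

End SeriesRing.

Arguments svar {d R} i.
Arguments sconst {d R} c.

(* f(g_1, ..., g_d), for series g_i without constant term: the terms of f of
   degree > mdeg m do not contribute to the coefficient of m. *)
Definition ssubst (R : comNzRingType) d e (g : d.-tuple {series R[e]})
    (f : {series R[d]}) : {series R[e]} :=
  Series (fun m => \sum_(k : 'X_{1..d < (mdeg m).+1})
    scoef f k * scoef (\prod_i tnth g i ^+ k i) m).

Section SeriesIdomain.
Variables (d : nat) (R : idomainType).

Lemma series_lead (f : {series R[d]}) : f != 0 ->
  exists2 m, scoef f m != 0 & forall k, (k < m)%O -> scoef f k = 0.
Proof.
move=> nz_f; have [m0 nz_m0] : exists m, scoef f m != 0.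
  apply: contrapT => none; case/eqP: nz_f; apply: seriesP => m /=.
  by apply/eqP; apply: contrapT => /negP nz; apply: none; exists m.
elim/(well_founded_ind (@ltom_wf d)): m0 nz_m0 => m IHm nz_m.
have [[k [lt_km nz_k]]|none] := pselect (exists k, (k < m)%O /\ scoef f k != 0).
  exact: (IHm k).
exists m => // k lt_km; apply/eqP; apply: contrapT => /negP nz_k.
by apply: none; exists k.
Qed.

Lemma series_mulf_eq0 : GRing.integral_domain_axiom {series R[d]}.
Proof.
move=> f g fg0; apply/norP => -[/series_lead [a nza lta] /series_lead [b nzb ltb]].
move/(congr1 (fun h => scoef h (a + b)%MM)): fg0 => /eqP; rewrite scoefM /=.
have lta_b : (mdeg a < (mdeg (a + b)).+1)%N by rewrite mdegD ltnS leq_addr.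
have ltb_a : (mdeg b < (mdeg (a + b)).+1)%N by rewrite mdegD ltnS leq_addl.
rewrite (bigD1 (BMultinom lta_b, BMultinom ltb_a)) //= big1.
  by rewrite addr0 mulf_eq0 (negPf nza) (negPf nzb).
case=> k1 k2 /= /andP[eab nek].
case: (ltgtP (k1 : 'X_{1..d}) a) => [/lta -> | gta | eqa]; first by rewrite mul0r.
- case: (ltP (k2 : 'X_{1..d}) b) => [/ltb -> | geb]; first by rewrite mulr0.
  by have := lt_eqF (ltmc_le_add gta geb); rewrite eab.
- case/eqP: nek; congr pair; apply: val_inj => //=.
  by apply/(@addmI _ a)/eqP; rewrite -{1}eqa eq_sym.
Qed.

HB.instance Definition _ :=
  GRing.ComUnitRing_isIntegral.Build {series R[d]} series_mulf_eq0.

End SeriesIdomain.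

Notation "{ 'sfrac' T [ d ] }" := {fraction {series T[d]}} : type_scope.
Notation "x %:F" := (@FracField.tofrac _ x).

(* f |-> frac_map f extends h to fractions; meaningful when h is an injective
   ring morphism, in which case frac_mapE applies. *)
Definition frac_map (R S : idomainType) (h : R -> S) (q : {fraction R}) :
    {fraction S} :=
  (h \n_(repr q))%:F / (h \d_(repr q))%:F.

Lemma frac_mapE (R S : idomainType) (h : R -> S) (a b : R) :
    {morph h : u v / u * v} -> (forall u, h u = 0 -> u = 0) -> b != 0 ->
  frac_map h (a%:F / b%:F) = (h a)%:F / (h b)%:F.
Proof.
move=> hM h_inj nzb; rewrite /frac_map; set q := a%:F / b%:F.
have nz_h u : u != 0 -> h u != 0.
  by move=> nzu; apply/eqP => /h_inj u0; rewrite u0 eqxx in nzu.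
have nzd : \d_(repr q) != 0 by apply: denom_ratioP.
have Eq : q = (\n_(repr q))%:F / (\d_(repr q))%:F.
  rewrite -{1}[q]reprK -{1}[repr q]Ratio_numden.
  move: nzd; move: (\n_(repr q)) (\d_(repr q)) => n e nze.
  apply: (@mulIf _ e%:F); first by rewrite tofrac_eq0.
  rewrite divfK ?tofrac_eq0 //; unlock FracField.tofrac.
  rewrite -[LHS]FracField.pi_mul /FracField.mulf.
  apply/eqP; rewrite piE FracField.equivfE !numden_Ratio ?mulf_neq0 ?oner_eq0 //.
  by rewrite !mulr1 mulrC.
have /eqP: q * b%:F * (\d_(repr q))%:F = a%:F * (\d_(repr q))%:F.
  by rewrite /q divfK ?tofrac_eq0.
rewrite {1}Eq mulrAC divfK ?tofrac_eq0 // -!tofracM tofrac_eq => /eqP E.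
apply: (@mulIf _ ((h b)%:F * (h \d_(repr q))%:F)).
  by rewrite mulf_neq0 // tofrac_eq0 nz_h.
rewrite mulrCA divfK ?tofrac_eq0 ?nz_h // mulrA divfK ?tofrac_eq0 ?nz_h //.
by rewrite -!tofracM -!hM -E mulrC.
Qed.

Section Tensor.
Variables (R : comNzRingType) (n : nat).
Implicit Types a b : 'M[R]_n.

Definition trace_form a b : R := \tr (a *m b).

Definition casimir : 'M[R]_(n * n) :=
  \sum_(i < n) \sum_(j < n) delta_mx i j *t delta_mx j i.

Lemma casimirE (b bs : 'I_(n * n) -> 'M[R]_n) :
    (forall i j, trace_form (bs i) (b j) = (i == j)%:R) ->
  casimir = \sum_i bs i *t b i.
Proof.
move=> dual_b.
pose M : 'M[R]_(n * n) :=
  \matrix_(i, p) bs i (mxtens_unindex p).1 (mxtens_unindex p).2.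
pose N : 'M[R]_(n * n) :=
  \matrix_(p, i) b i (mxtens_unindex p).2 (mxtens_unindex p).1.
have MN : M *m N = 1%:M.
  apply/matrixP=> i j; rewrite !mxE -dual_b /trace_form /mxtrace.
  under [RHS]eq_bigr do rewrite mxE.
  rewrite pair_big /= (reindex (@mxtens_index n n)) /=.
    by apply: eq_bigr => -[p q] _; rewrite !mxE !mxtens_indexK.
  by exists (@mxtens_unindex n n) => p _; rewrite (mxtens_indexK, mxtens_unindexK).
have /matrixP NM := mulmx1C MN; apply/matrixP=> p q.
case: (mxtens_indexP p) => p1 p2; case: (mxtens_indexP q) => q1 q2.
have := NM (mxtens_index (q2, p2)) (mxtens_index (p1, q1)).
rewrite /casimir !mxE (can_eq (@mxtens_indexK n n)) xpair_eqE => E.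
transitivity (((q2 == p1) && (p2 == q1))%:R : R).
  rewrite summxE (bigD1 p1) //= [X in _ + X]big1 ?addr0; last first.
    move=> i ne_i; rewrite summxE big1 // => j _; rewrite tensmxE !mxE.
    by rewrite eq_sym (negPf ne_i) mul0r.
  rewrite summxE (bigD1 q1) //= [X in _ + X]big1 ?addr0; last first.
    move=> j ne_j; rewrite tensmxE !mxE [q1 == j]eq_sym (negPf ne_j) andbF.
    by rewrite mul0r.
  by rewrite tensmxE !mxE !eqxx mul1r andbC.
rewrite -E summxE; apply: eq_bigr => i _.
by rewrite tensmxE !mxE !mxtens_indexK mulrC.
Qed.

(* The linear map on (A (x) A) (x)_R S induced by a bilinear map F on A x A. *)
Definition tens_lift (S : comNzRingType) (V : lmodType S)
    (F : 'M[R]_n -> 'M[R]_n -> V) (t : 'M[S]_(n * n)) : V :=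
  \sum_(i < n) \sum_(j < n) \sum_(k < n) \sum_(l < n)
    t (mxtens_index (i, k)) (mxtens_index (j, l))
      *: F (delta_mx i j) (delta_mx k l).

Lemma tens_liftE (V : lmodType R) (F : 'M[R]_n -> 'M[R]_n -> V) a b :
    (forall c, linear (F c)) -> (forall c, linear (F^~ c)) ->
  tens_lift F (a *t b) = F a b.
Proof.
move=> linr linl.
have sumr (G : 'M[R]_n -> V) : linear G ->
    forall c, G c = \sum_i \sum_j c i j *: G (delta_mx i j).
  move=> linG c; pose L := GRing.isLinear.Build _ _ _ _ G linG.
  pose H : {linear 'M[R]_n -> V} := HB.pack G L.
  rewrite -[G]/(H : _ -> _) {1}[c]matrix_sum_delta linear_sum.
  by apply: eq_bigr => i _; rewrite linear_sum; apply: eq_bigr => j _; rewrite linearZ.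
rewrite (sumr _ (linl b) a); apply: eq_bigr => i _; apply: eq_bigr => j _.
rewrite (sumr _ (linr _) b) scaler_sumr; apply: eq_bigr => k _.
rewrite scaler_sumr; apply: eq_bigr => l _.
by rewrite tensmxE scalerA.
Qed.

Definition leg12 : 'M[R]_(n * n) -> 'M[R]_(n * n * n) :=
  tens_lift (fun a b => a *t b *t (1%:M : 'M[R]_n)).
Definition leg13 : 'M[R]_(n * n) -> 'M[R]_(n * n * n) :=
  tens_lift (fun a b => a *t (1%:M : 'M[R]_n) *t b).
Definition leg23 : 'M[R]_(n * n) -> 'M[R]_(n * n * n) :=
  tens_lift (fun a b => (1%:M : 'M[R]_n) *t a *t b).

Definition alg_aut (phi : 'M[R]_n -> 'M[R]_n) : Prop :=
  [/\ bijective phi, linear phi, phi 1%:M = 1%:M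
    & {morph phi : a b / a *m b}].

End Tensor.

Section CYBE.
Variables (k : fieldType) (n : nat).

Local Notation x := (svar 0 : {series k[2]}).
Local Notation y := (svar 1 : {series k[2]}).
Local Notation z i := (svar i : {series k[3]}).

Definition sfconst d (c : k) : {sfrac k[d]} := (sconst c)%:F.

(* (A (x) A)[[x, y]][(x - y)^-1], inside the matrices over the fraction field
   of k[[x, y]]. *)
Definition is_polar (r : 'M[{sfrac k[2]}]_(n * n)) : Prop :=
  exists (N : nat) (f : 'M[{series k[2]}]_(n * n)),
    r = map_mx (fun c => c%:F / ((x - y) ^+ N)%:F) f.

(* r^{ij} = r(z_i, z_j) before placement in the tensor legs. *)
Definition in_vars (i j : 'I_3) (r : 'M[{sfrac k[2]}]_(n * n)) :
    'M[{sfrac k[3]}]_(n * n) :=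
  map_mx (frac_map (ssubst [tuple z i; z j])) r.

Definition CYBE (r : 'M[{sfrac k[2]}]_(n * n)) : Prop :=
  let r12 := leg12 (in_vars 0 1 r) in
  let r13 := leg13 (in_vars 0 2 r) in
  let r23 := leg23 (in_vars 1 2 r) in
  r13 *m r12 - r12 *m r23 + r23 *m r13 = 0.

Definition solution (r : 'M[{sfrac k[2]}]_(n * n)) : Prop :=
  is_polar r /\ CYBE r.

(* phi(w) applied to a constant matrix a, for phi an endomorphism of
   A[[z]] = M_n(k[[z]]). *)
Definition aut_at (phi : 'M[{series k[1]}]_n -> 'M[{series k[1]}]_n)
    (w : {series k[2]}) (a : 'M[k]_n) : 'M[{sfrac k[2]}]_n :=
  map_mx (fun c => (ssubst [tuple w] c)%:F) (phi (map_mx (@sconst 1 k) a)).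

Definition equivalent (r1 r2 : 'M[{sfrac k[2]}]_(n * n)) : Prop :=
  exists (phi : 'M[{series k[1]}]_n -> 'M[{series k[1]}]_n)
         (v : {series k[1]}),
    let u := svar 0 * v in
    let u_at w := ssubst [tuple w] u in
    [/\ alg_aut phi, v \is a GRing.unit
      & tens_lift (fun a b => aut_at phi x a *t aut_at phi y b)
          (map_mx (frac_map (ssubst [tuple u_at x; u_at y])) r1) = r2].

Definition casimir_frac : 'M[{sfrac k[2]}]_(n * n) :=
  map_mx (@sfconst 2) (casimir k n).

Definition quasi_trigonometric (r : 'M[{sfrac k[2]}]_(n * n)) : Prop :=
  solution r /\
  exists t : 'M[{mpoly k[2]}]_(n * n),
    equivalent r
      ((y%:F / (x - y)%:F) *: casimir_frac
       + map_mx (fun p => (series_of_mpoly p)%:F) t).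

(* exp(g), for g without constant term. *)
Definition sexp d (g : {series k[d]}) : {series k[d]} :=
  Series (fun m =>
    \sum_(j < (mdeg m).+1) scoef (g ^+ j) m / (j`!)%:R).

Definition finite_order (sigma : 'M[k]_n -> 'M[k]_n) (m : nat) : Prop :=
  [/\ (0 < m)%N, iter m sigma =1 id
    & forall j, (0 < j < m)%N -> ~ (iter j sigma =1 id)].

(* Elements of A[v, v^-1]: a is the finitely supported family of the
   coefficients a_j of v^j. *)
Definition laurent := {fsfun int -> 'M[k]_n with 0}.

(* a(eps v) = sigma(a(v)), compared coefficientwise. *)
Definition twisted_loop (sigma : 'M[k]_n -> 'M[k]_n) (eps : k) (a : laurent) :
    Prop :=
  forall j : int, eps ^ j *: a j = sigma (a j).

Definition laurent_at (w : {sfrac k[2]}) (a : laurent) : 'M[{sfrac k[2]}]_n :=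
  \sum_(j <- finsupp a) w ^ j *: map_mx (@sfconst 2) (a j).

Definition trigonometric (r : 'M[{sfrac k[2]}]_(n * n)) : Prop :=
  solution r /\
  exists (sigma : 'M[k]_n -> 'M[k]_n) (m : nat) (eps : k)
         (gamma : 'I_m -> 'M[k]_(n * n)) (s : seq (laurent * laurent)),
    [/\ alg_aut sigma,
        forall a b, trace_form (sigma a) (sigma b) = trace_form a b,
        finite_order sigma m
      & m.-primitive_root eps] /\
    [/\ casimir k n = \sum_j gamma j,
        forall j : 'I_m,
          tens_lift (fun a b => sigma a *t b) (gamma j) = eps ^+ j *: gamma j,
        forall p, p \in s ->
          twisted_loop sigma eps p.1 /\ twisted_loop sigma eps p.2
      & let expm (c : k) (w : {series k[2]}) :=
          (sexp (sconst (c / m%:R) * w))%:F in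
        equivalent r
          ((sexp (x - y) - 1)%:F^-1
             *: (\sum_(j < m) expm j%:R (x - y)
                   *: map_mx (@sfconst 2) (gamma j))
           + \sum_(p <- s)
               laurent_at (expm 1 x) p.1 *t laurent_at (expm 1 y) p.2)].

End CYBE.

(* Main.v *)
From HB Require Import structures.
Require Import Defs.
From mathcomp Require Import all_boot all_order all_algebra.
From mathcomp Require Import finmap.
From mathcomp Require Import mpoly boolp mxtens ring.

(* Equivalence preserves the A-CYBE, and both standard forms are rational: up
   to the coordinate change x |-> exp(x / m) they read
     r(X, Y) = Y^m / (X^m - Y^m) sum_j (X / Y)^j gamma_j + s(X, Y)
   with s a Laurent polynomial and sum_j gamma_j = gamma (for the
   quasi-trigonometric form m = 1).  Since gamma is the flip of V (x) V,
   contracting the A-CYBE against gamma in the legs 1, 2 makes the pole along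
   X_1 = X_2 cancel and leaves the Riccati equation
     m r^2 = - 1 (x) D tr_1 r,   D = X d/dX,
   and the legs 2, 3 give r^2 = c (x) 1.  So r^2 is a scalar f proportional to
   D tau, tau = tr r.  Differentiating r^2 = f and taking the trace of the
   product with r yields 2 f D tau = tau D f, that is D^2 (1 / tau) = 0.  A
   rational function of X whose D-derivative is constant has derivative zero
   (there is no logarithm), hence tau is constant, in contradiction with its
   pole at X = Y. *)

Set Implicit Arguments.
Unset Strict Implicit.
Unset Printing Implicit Defensive.

Import GRing.Theory.
Local Open Scope ring_scope.

(** * Series and their orders *)

(** The obstacle is that the poles lie exactly on the diagonals where the equation has to be
    examined. Writing r = T / b and multiplying the A-CYBE by b12 b13 b23 gives an identity in an
    integral domain that may be specialised to a diagonal; there every contracted term has a factor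
    that vanishes, and the residue information is read off from the first derivative. The remaining
    freedom is removed by setting the third variable to 1, so that all computations concern r(X, 1),
    a matrix over [{poly k}] divided by one polynomial. Passing from power series to polynomials
    needs no convergence: the map X_i |-> w(z_i), with w = z or w = exp(z / m), is injective on
    polynomials, because w minus its constant term has a nonzero linear coefficient. Characteristic
    0 enters through the factorials, through the comparison of exponents at X = 0, and through m n
    != 0, which is the value at X = 1 that yields the contradiction. *)

Section Order.
Variables (d : nat) (R : comNzRingType).
Implicit Types (f g h : {series R[d]}) (m : 'X_{1..d}).

Lemma scoefD f g m : scoef (f + g) m = scoef f m + scoef g m.
Proof. by []. Qed.

Lemma scoefN f m : scoef (- f) m = - scoef f m.
Proof. by []. Qed.

Lemma scoef1 m : scoef (1 : {series R[d]}) m = (m == 0%MM)%:R.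
Proof. by rewrite /=; case: eqP. Qed.

Lemma scoef_sum I (r : seq I) (P : pred I) (F : I -> {series R[d]}) m :
  scoef (\sum_(i <- r | P i) F i) m = \sum_(i <- r | P i) scoef (F i) m.
Proof. exact: (big_morph (fun f => scoef f m)). Qed.

(** Membership in the D-th power of the ideal generated by the variables. Identities of series are
    proved modulo every such power ([sord_eq0]), where truncations are available. *)
Definition sord D f := forall m, (mdeg m < D)%N -> scoef f m = 0.

Lemma sord_eq0 f : (forall D, sord D f) -> f = 0.
Proof. by move=> ord_f; apply: seriesP => m; apply: (ord_f (mdeg m).+1). Qed.

Lemma sordW D E f : (E <= D)%N -> sord D f -> sord E f.
Proof. by move=> leED ord_f m ltmE; apply/ord_f/(leq_trans ltmE). Qed.

Lemma sordD D f g : sord D f -> sord D g -> sord D (f + g).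
Proof. by move=> Df Dg m ltm; rewrite scoefD Df ?Dg ?addr0. Qed.

Lemma sordN D f : sord D f -> sord D (- f).
Proof. by move=> Df m ltm; rewrite scoefN Df ?oppr0. Qed.

Lemma sord_sum D I (r : seq I) (P : pred I) (F : I -> {series R[d]}) :
  (forall i, P i -> sord D (F i)) -> sord D (\sum_(i <- r | P i) F i).
Proof. by move=> DF m ltm; rewrite scoef_sum big1 // => i /DF ->. Qed.

Lemma sordM D E f g : sord D f -> sord E g -> sord (D + E) (f * g).
Proof.
move=> Df Eg m ltm; rewrite scoefM big1 // => -[k1 k2] /= /eqP em.
have [ltk1|lek1] := ltnP (mdeg k1) D; first by rewrite Df ?mul0r.
rewrite Eg ?mulr0 // -(ltn_add2l (mdeg k1)) -mdegD -em.
by rewrite (leq_trans ltm) ?leq_add2r.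
Qed.

Lemma sordMl D f g : sord D g -> sord D (f * g).
Proof. by move=> Dg; rewrite -[D]add0n; apply: sordM. Qed.

Lemma sordX D j f : sord D f -> sord (D * j) (f ^+ j).
Proof.
move=> Df; elim: j => [|j IHj]; first by rewrite muln0.
by rewrite mulnS exprS; apply: sordM.
Qed.

Lemma sord_prod (I : Type) (r : seq I) (D : I -> nat) (F : I -> {series R[d]}) :
  (forall i, sord (D i) (F i)) -> sord (\sum_(i <- r) D i) (\prod_(i <- r) F i).
Proof.
move=> DF; elim: r => [|i r IHr]; first by rewrite !big_nil.
by rewrite !big_cons; apply: sordM.
Qed.

Lemma sord_svar i : sord 1 (svar i : {series R[d]}).
Proof.
move=> m /=; rewrite ltnS leqn0 mdeg_eq0 => /eqP->.
by case: eqP => // /(congr1 mdeg); rewrite mdeg1 mdeg0.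
Qed.

Lemma eq_sordM D f f' g g' : sord D (f - f') -> sord D (g - g') ->
  sord D (f * g - f' * g').
Proof.
move=> Df Dg; rewrite -(subrK (f * g') (f * g)) -addrA -mulrBr -mulrBl.
by apply: sordD; rewrite 1?[_ * g']mulrC; apply: sordMl.
Qed.

Lemma eq_sord_coef D f g m : sord D (f - g) -> (mdeg m < D)%N ->
  scoef f m = scoef g m.
Proof. by move=> Dfg /Dfg /eqP; rewrite scoefD scoefN subr_eq0 => /eqP. Qed.

Lemma sconst_is_additive : {morph (@sconst d R) : x y / x - y}.
Proof.
by move=> x y; apply: seriesP => m /=; case: eqP => //; rewrite subr0.
Qed.

HB.instance Definition _ :=
  GRing.isZmodMorphism.Build R {series R[d]} (@sconst d R) sconst_is_additive.

Lemma scoef_sconstM c f m : scoef (sconst c * f) m = c * scoef f m.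
Proof.
have E : scoef (smul (sconst c) f) m = (c *: strunc (mdeg m).+1 f)@_m.
  rewrite -mul_mpolyC; apply/esym/mulm_coefE => k lek.
    by rewrite mcoeffC /= eq_sym; case: eqP; rewrite ?mulr1 ?mulr0.
  by rewrite strunc_coef.
by rewrite [LHS]E mcoeffZ strunc_coef.
Qed.

Lemma sconst_is_monoid_morphism : monoid_morphism (@sconst d R).
Proof.
split=> // x y; apply: seriesP => m; rewrite scoef_sconstM /=.
by case: eqP; rewrite ?mulr0.
Qed.

HB.instance Definition _ :=
  GRing.isMonoidMorphism.Build R {series R[d]} (@sconst d R)
    sconst_is_monoid_morphism.

Lemma series_of_mpoly_is_additive :
  {morph (@series_of_mpoly d R) : p q / p - q}.
Proof. by move=> p q; apply: seriesP => m /=; rewrite mcoeffB. Qed.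

HB.instance Definition _ := GRing.isZmodMorphism.Build {mpoly R[d]}
  {series R[d]} (@series_of_mpoly d R) series_of_mpoly_is_additive.

Lemma series_of_mpoly_is_monoid_morphism :
  monoid_morphism (@series_of_mpoly d R).
Proof.
split=> [|p q]; apply: seriesP => m; last exact: mulm_coefE.
by rewrite scoef1 /= mcoeff1.
Qed.

HB.instance Definition _ := GRing.isMonoidMorphism.Build {mpoly R[d]}
  {series R[d]} (@series_of_mpoly d R) series_of_mpoly_is_monoid_morphism.

Lemma series_of_mpolyC c : series_of_mpoly c%:MP = sconst c :> {series R[d]}.
Proof.
apply: seriesP => m /=; rewrite mcoeffC eq_sym.
by case: eqP; rewrite ?mulr1 ?mulr0.
Qed.

Lemma series_of_mpolyX i : series_of_mpoly 'X_i = svar i :> {series R[d]}.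
Proof. by apply: seriesP => m /=; rewrite mcoeffX eq_sym. Qed.

Lemma series_of_mpoly_inj (p : {mpoly R[d]}) : series_of_mpoly p = 0 -> p = 0.
Proof.
move=> p0; apply/mpolyP => m.
by rewrite -[LHS]/(scoef (series_of_mpoly p) m) p0 mcoeff0.
Qed.

Lemma sord_strunc D f : sord D (f - series_of_mpoly (strunc D f)).
Proof. by move=> m ltm; rewrite scoefD scoefN /= strunc_coef ?subrr. Qed.

End Order.

Lemma rmorph_mmap (R : nzRingType) n (S T : comNzRingType) (h : {rmorphism S -> T})
    (f : R -> S) (v : 'I_n -> S) p :
  h (mmap f v p) = mmap (h \o f) (h \o v) p.
Proof.
rewrite /mmap rmorph_sum /=; apply: eq_bigr => m _.
rewrite rmorphM; congr (_ * _); rewrite /mmap1 rmorph_prod.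
by apply: eq_bigr => i _; rewrite rmorphXn.
Qed.

Lemma eq_mmap (R S : nzRingType) n (f f' : R -> S) (v v' : 'I_n -> S) p :
  f =1 f' -> v =1 v' -> mmap f v p = mmap f' v' p.
Proof.
move=> ef ev; apply: eq_bigr => m _; rewrite ef; congr (_ * _).
exact: mmap1_eq.
Qed.

(** * Substitution of series as a ring morphism *)

Section Subst.
Variables (R : comNzRingType) (d e : nat) (g : d.-tuple {series R[e]}).
Implicit Types f h : {series R[d]}.

Definition speval (p : {mpoly R[d]}) : {series R[e]} := mmap sconst (tnth g) p.

Lemma speval_is_additive : {morph speval : p q / p - q}.
Proof. exact: raddfB. Qed.
HB.instance Definition _ := GRing.isZmodMorphism.Build _ _ _ speval_is_additive.
Lemma speval_is_monoid : monoid_morphism speval.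
Proof. by split=> [|p q]; rewrite /speval ?rmorph1 ?rmorphM. Qed.
HB.instance Definition _ := GRing.isMonoidMorphism.Build _ _ _ speval_is_monoid.

Lemma spevalC c : speval c%:MP = sconst c. Proof. exact: mmapC. Qed.
Lemma spevalX i : speval 'X_i = tnth g i.
Proof. by rewrite /speval mmapX mmap1U. Qed.

(** Each coefficient of a substituted series is a coefficient of a polynomial evaluation, so the
    ring axioms for [speval] can be transferred to [ssubst]. *)
Lemma ssubst_strunc f m :
  scoef (ssubst g f) m = scoef (speval (strunc (mdeg m).+1 f)) m.
Proof.
rewrite /strunc rmorph_sum scoef_sum /=; apply: eq_bigr => k _.
by rewrite /speval mmapZ mmapX scoef_sconstM.
Qed.

Hypothesis g0 : forall i, sord 1 (tnth g i).

Lemma sord_speval D (p : {mpoly R[d]}) :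
  (forall m, (mdeg m < D)%N -> p@_m = 0) -> sord D (speval p).
Proof.
move=> Dp; rewrite /speval /mmap big_seq; apply: sord_sum => m.
rewrite mcoeff_msupp => nzp.
have leDm : (D <= mdeg m)%N by rewrite leqNgt; apply: contra nzp => /Dp ->.
apply/sordMl/(sordW leDm); rewrite mdegE; apply: sord_prod => i.
by have := @sordX _ _ 1 (m i) _ (g0 i); rewrite mul1n.
Qed.

(** Continuity of substitution: since the g_i have no constant term, a monomial of degree at least D
    is sent to order at least D, and a polynomial approximation of f may replace f. *)
Lemma sord_ssubst_poly D f p : sord D (f - series_of_mpoly p) ->
  sord D (ssubst g f - speval p).
Proof.
move=> Dfp m ltm; rewrite scoefD scoefN ssubst_strunc -scoefN -scoefD -rmorphB.
apply: (@sord_speval (mdeg m).+1) => // k; rewrite ltnS => lek.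
rewrite mcoeffB strunc_coef ?ltnS // (eq_sord_coef Dfp) ?subrr //.
exact: leq_ltn_trans ltm.
Qed.

Lemma ssubst_poly p : ssubst g (series_of_mpoly p) = speval p.
Proof.
apply/eqP; rewrite -subr_eq0; apply/eqP/sord_eq0 => D.
by apply: sord_ssubst_poly; rewrite subrr.
Qed.

Lemma ssubst_is_additive : {morph ssubst g : f h / f - h}.
Proof.
move=> f h; apply: seriesP => m; rewrite scoefD scoefN /= -sumrB.
by apply: eq_bigr => k _; rewrite mulrBl.
Qed.

Lemma ssubst_is_monoid_morphism : monoid_morphism (ssubst g).
Proof.
split=> [|f h].
  by rewrite -(rmorph1 (@series_of_mpoly d R)) ssubst_poly rmorph1.
apply/eqP; rewrite -subr_eq0; apply/eqP/sord_eq0 => D.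
set p := strunc D f; set q := strunc D h.
rewrite -(subrK (speval (p * q)) (ssubst g (f * h))) -addrA.
apply: sordD; first apply: sord_ssubst_poly.
  by rewrite rmorphM; apply: eq_sordM; apply: sord_strunc.
rewrite -[_ - _]opprK; apply: sordN; rewrite opprB rmorphM.
by apply: eq_sordM; apply/sord_ssubst_poly/sord_strunc.
Qed.

Lemma sord_ssubst D f : sord D f -> sord D (ssubst g f).
Proof.
move=> Df; rewrite -[ssubst g f]subr0 -(rmorph0 speval).
by apply: sord_ssubst_poly; rewrite rmorph0 subr0.
Qed.

Lemma ssubst_const c : ssubst g (sconst c) = sconst c.
Proof. by rewrite -series_of_mpolyC ssubst_poly spevalC. Qed.

Lemma ssubst_svar i : ssubst g (svar i) = tnth g i.
Proof. by rewrite -series_of_mpolyX ssubst_poly spevalX. Qed.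

End Subst.

Definition ssubst_morph (R : comNzRingType) d e (g : d.-tuple {series R[e]})
    (_ : forall i, sord 1 (tnth g i)) : {series R[d]} -> {series R[e]} :=
  ssubst g.

HB.instance Definition _ R d e g g0 := GRing.isZmodMorphism.Build _ _
  (@ssubst_morph R d e g g0) (@ssubst_is_additive R d e g).
HB.instance Definition _ R d e g g0 := GRing.isMonoidMorphism.Build _ _
  (@ssubst_morph R d e g g0) (@ssubst_is_monoid_morphism R d e g g0).

Lemma ssubst_morphE (R : comNzRingType) d e (g : d.-tuple {series R[e]}) g0 f :
  ssubst g f = @ssubst_morph R d e g g0 f.
Proof. by []. Qed.

(** * Substitution and exponentials *)

(** A ring morphism that fixes constants commutes with polynomial evaluation; preservation of orders
    extends this to series, modulo each order D. *)
Lemma rmorph_ssubst (R : comNzRingType) d e f (h : {rmorphism {series R[d]} -> {series R[e]}})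
    (g : f.-tuple {series R[d]}) (g' : f.-tuple {series R[e]}) s :
    (forall D u, sord D u -> sord D (h u)) -> (forall c, h (sconst c) = sconst c) ->
    (forall i, sord 1 (tnth g i)) -> (forall i, tnth g' i = h (tnth g i)) ->
  h (ssubst g s) = ssubst g' s.
Proof.
move=> ord_h hC g0 g'E.
have g'0 i : sord 1 (tnth g' i) by rewrite g'E; apply: ord_h.
apply/eqP; rewrite -subr_eq0; apply/eqP/sord_eq0 => D.
set p := strunc D s.
rewrite -(subrK (h (speval g p)) (h (ssubst g s))) -addrA; apply: sordD.
  by rewrite -rmorphB; apply/ord_h/(sord_ssubst_poly g0)/sord_strunc.
rewrite -[_ - _]opprK; apply: sordN; rewrite opprB.
have -> : h (speval g p) = speval g' p.
  by rewrite [LHS]rmorph_mmap; apply: eq_mmap => [c|i]; rewrite ?g'E //; apply: hC.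
exact/(sord_ssubst_poly g'0)/sord_strunc.
Qed.

Lemma ssubst_comp (R : comNzRingType) c d e (g : d.-tuple {series R[e]})
    (h : c.-tuple {series R[d]}) (gh : c.-tuple {series R[e]}) f :
    (forall i, sord 1 (tnth g i)) -> (forall i, sord 1 (tnth h i)) ->
    (forall i, tnth gh i = ssubst g (tnth h i)) ->
  ssubst g (ssubst h f) = ssubst gh f.
Proof.
move=> g0 h0 ghE.
by apply: (@rmorph_ssubst _ _ _ _ (ssubst_morph g0)) => // *;
   [apply: sord_ssubst | apply: ssubst_const].
Qed.

Lemma series_of_mpolyE (R : comNzRingType) d (g : d.-tuple {series R[d]}) p :
  (forall i, tnth g i = svar i) -> series_of_mpoly p = speval g p.
Proof.
move=> gE; rewrite -{1}[p]comp_mpoly_id [LHS]rmorph_mmap.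
apply: eq_mmap => [c|i] /=; first exact: series_of_mpolyC.
by rewrite tnth_mktuple gE series_of_mpolyX.
Qed.

Lemma ssubst_id (R : comNzRingType) d (g : d.-tuple {series R[d]}) f :
  (forall i, tnth g i = svar i) -> ssubst g f = f.
Proof.
move=> gE; apply: seriesP => m; rewrite ssubst_strunc -series_of_mpolyE //=.
by rewrite strunc_coef.
Qed.

Lemma scoef_mulX (R : comNzRingType) d (f : {series R[d]}) c k m :
    sord 1 (f - sconst c) -> (mdeg m <= mdeg k)%N ->
  scoef (series_of_mpoly 'X_[k] * f) m = c *+ (k == m).
Proof.
move=> fc lemk; rewrite -[f](subrK (sconst c)) mulrDr scoefD.
rewrite (_ : scoef _ m = 0) ?add0r; last first.
  apply: (@sordM _ _ (mdeg k) 1) => //; last by rewrite addn1.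
  move=> j ltj /=; rewrite mcoeffX; case: eqP => // kj.
  by rewrite kj ltnn in ltj.
by rewrite mulrC scoef_sconstM /= mcoeffX mulr_natr.
Qed.

(** The lowest monomial m of f survives: up to higher order, the substitution multiplies a monomial
    of degree D by c ^ D, so the coefficient of m in the image is that of f times c ^ (deg m). *)
Lemma ssubst_inj (R : idomainType) d (g : d.-tuple {series R[d]})
    (v : 'I_d -> {series R[d]}) c :
    c != 0 -> (forall i, tnth g i = svar i * v i) ->
    (forall i, sord 1 (v i - sconst c)) ->
  forall f, ssubst g f = 0 -> f = 0.
Proof.
move=> nzc gE vc f gf0; apply: contrapT => /eqP /series_lead [m nzm ltm].
move: gf0 => /(congr1 (fun s => scoef s m)) /eqP; apply/negP => /=.
have coefX (k : 'X_{1..d}) : (mdeg m <= mdeg k)%N ->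
    scoef (\prod_i tnth g i ^+ k i) m = c ^+ mdeg k *+ (k == m).
  move=> lemk.
  have -> : \prod_i tnth g i ^+ k i
      = series_of_mpoly 'X_[k] * \prod_i v i ^+ k i.
    rewrite (mpolyXE_id R) rmorph_prod -big_split /=; apply: eq_bigr => i _.
    by rewrite rmorphXn /= series_of_mpolyX gE exprMn.
  apply: scoef_mulX lemk.
  have : (forall i, sord 1 (v i - sconst c)) ->
    sord 1 (\prod_i v i ^+ k i - \prod_(i < d) sconst c ^+ k i).
    move=> vc'; elim/big_rec2: _ => [|i x y _ xy]; first by rewrite subrr.
    apply: eq_sordM xy; elim: (k i) => [|j IHj]; first by rewrite subrr.
    by rewrite !exprS; apply: eq_sordM.
  by move/(_ vc); rewrite -expr_sum -mdegE -rmorphXn.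
rewrite (bigD1 (BMultinom (ltnSn (mdeg m)))) //= coefX // eqxx mulr1n.
rewrite big1 ?addr0 ?mulf_neq0 ?expf_neq0 // => -[k ltk] /= nek.
have [lemk|ltkm] := leqP (mdeg m) (mdeg k).
  rewrite coefX // (_ : (k == m) = false) ?mulr0 //.
  by apply: contra_neqF nek => /eqP km; apply: val_inj.
(* The monomial order compares degrees first, so monomials of smaller degree precede m and are
   absent from f. *)
by rewrite ltm ?mul0r // lt_mdeg_ltmc.
Qed.

Section PowerSeries.
Variables (R : comNzRingType) (d : nat).
Implicit Types (a : nat -> R) (g : {series R[d]}).

Definition spow a g : {series R[d]} :=
  Series (fun m => \sum_(j < (mdeg m).+1) scoef (g ^+ j) m * a j).

Lemma scoef_spow a g m :
  scoef (spow a g) m = \sum_(j < (mdeg m).+1) scoef (g ^+ j) m * a j.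
Proof. by []. Qed.

Lemma sord_spow a g N : sord 1 g ->
  sord N (spow a g - \sum_(j < N) sconst (a j) * g ^+ j).
Proof.
move=> g1 m ltm; rewrite scoefD scoefN scoef_sum scoef_spow; apply/eqP.
rewrite subr_eq0; apply/eqP; under [RHS]eq_bigr do rewrite scoef_sconstM mulrC.
rewrite (big_ord_widen_cond N predT (fun j => scoef (g ^+ j) m * a j) ltm).
rewrite [RHS](bigID (fun j : 'I_N => (j < (mdeg m).+1)%N)) /=.
rewrite [X in _ + X]big1 ?addr0 // => j; rewrite -leqNgt => ltmj.
by rewrite (@sordX _ _ 1 j) ?mul1n ?mul0r.
Qed.

(** Splitting off the constant term exhibits exp(c z) as 1 + z v with v(0) != 0 when c != 0, the
    form required by the injectivity argument for w(z). *)
Lemma spow_shift a g : sord 1 g ->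
  spow a g = sconst (a 0) + g * spow (fun j => a j.+1) g.
Proof.
move=> g1; apply/eqP; rewrite -subr_eq0; apply/eqP/sord_eq0 => N.
apply: (@sordW _ _ N.+1) => //.
set p := \sum_(j < N) sconst (a j.+1) * g ^+ j.
have -> : spow a g - (sconst (a 0) + g * spow (fun j => a j.+1) g) =
  (spow a g - \sum_(j < N.+1) sconst (a j) * g ^+ j)
  - g * (spow (fun j => a j.+1) g - p).
  rewrite big_ord_recl expr0 mulr1 mulrBr /p mulr_sumr.
  rewrite (eq_bigr (fun i : 'I_N => g * (sconst (a i.+1) * g ^+ i))).
    by ring.
  by move=> i _; rewrite mulrCA exprS.
apply: sordD; first exact: sord_spow.
by apply: sordN; rewrite -add1n; apply: sordM => //; apply: sord_spow.
Qed.

End PowerSeries.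

Lemma ssubst_spow (R : comNzRingType) d e (g : d.-tuple {series R[e]}) a h :
  (forall i, sord 1 (tnth g i)) -> sord 1 h ->
  ssubst g (spow a h) = spow a (ssubst g h).
Proof.
move=> g0 h1; apply/eqP; rewrite -subr_eq0; apply/eqP/sord_eq0 => N.
have gh1 : sord 1 (ssubst g h) by apply: sord_ssubst.
set p := \sum_(j < N) sconst (a j) * h ^+ j.
rewrite -(subrK (ssubst g p) (ssubst g (spow a h))) -addrA; apply: sordD.
  by rewrite !(ssubst_morphE g0) -rmorphB; apply: sord_ssubst => //; apply: sord_spow.
rewrite -[_ - _]opprK; apply: sordN; rewrite opprB.
rewrite (_ : ssubst g p = \sum_(j < N) sconst (a j) * (ssubst g h) ^+ j).
  exact: sord_spow.
rewrite (ssubst_morphE g0) rmorph_sum; apply: eq_bigr => j _.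
by rewrite rmorphM rmorphXn /= /ssubst_morph ssubst_const.
Qed.

Lemma sum_triangle (V : nmodType) N (F : nat -> nat -> V) :
  \sum_(l < N) \sum_(i < l.+1) F (l - i)%N i =
  \sum_(i < N) \sum_(j < N - i) F j i.
Proof.
elim: N => [|N IHN]; first by rewrite !big_ord0.
rewrite big_ord_recr /= IHN [RHS]big_ord_recr /= subSnn big_ord1.
rewrite [X in _ + X = _]big_ord_recr /= subnn addrA; congr (_ + _).
rewrite -big_split /=; apply: eq_bigr => i _.
by rewrite subSn ?big_ord_recr //= ltnW.
Qed.

Section Exp.
Variables (k : fieldType) (d : nat).
Hypothesis char0 : [pchar k] =i pred0.
Implicit Types (g h : {series k[d]}).

Lemma sexpE g : sexp g = spow (fun j => (j`!%:R)^-1) g.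
Proof. by []. Qed.

Lemma fact_neq0 j : j`!%:R != 0 :> k.
Proof. by move/pcharf0P: char0 => ->; rewrite -lt0n fact_gt0. Qed.

(** Modulo order N the exponentials are polynomials of degree below N. The binomial formula sums g^i
    h^j / (i! j!) over the triangle i + j < N, the product sums it over the square. *)
Lemma sexpD g h : sord 1 g -> sord 1 h -> sexp (g + h) = sexp g * sexp h.
Proof.
move=> g1 h1; apply/eqP; rewrite -subr_eq0; apply/eqP/sord_eq0 => N.
pose T f : {series k[d]} := \sum_(j < N) sconst (j`!%:R)^-1 * f ^+ j.
have T_ok f : sord 1 f -> sord N (sexp f - T f).
  by move=> f1; rewrite sexpE; apply: (@sord_spow _ _ _ f N f1).
rewrite -(subrK (T (g + h)) (sexp (g + h))) -addrA; apply: sordD.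
  exact/T_ok/sordD.
rewrite -(subrK (T g * T h) (T (g + h))) -addrA; apply: sordD; last first.
  rewrite -[_ - _]opprK; apply: sordN; rewrite opprB.
  by apply: eq_sordM; apply: T_ok.
pose F i j : {series k[d]} :=
  (sconst (i`!%:R)^-1 * g ^+ i) * (sconst (j`!%:R)^-1 * h ^+ j).
have -> : T (g + h) = \sum_(j < N) \sum_(i < N - j) F i j.
  rewrite -sum_triangle; apply: eq_bigr => l _.
  rewrite exprDn mulr_sumr; apply: eq_bigr => i _.
  rewrite /F mulrACA -rmorphM mulrnAr -mulrnAl -rmorphMn /=.
  congr (sconst _ * _); rewrite -mulr_natr.
  have lei : (i <= l)%N by rewrite -ltnS.
  apply: (mulfI (fact_neq0 l)); rewrite mulrA divff ?fact_neq0 // mul1r.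
  rewrite -(bin_fact lei) !natrM -mulrA [_ * (l - i)`!%:R]mulrC mulrACA.
  by rewrite !divff ?fact_neq0 // !mulr1.
have -> : T g * T h = \sum_(j < N) \sum_(i < N) F i j.
  by rewrite /T mulr_sumr; apply: eq_bigr => j _; rewrite mulr_suml.
(* Only pairs with i + j >= N remain, and their terms have order at least N. *)
rewrite -sumrB; apply: sord_sum => j _.
rewrite (big_ord_widen_cond N predT (F^~ j)) ?leq_subr //.
rewrite [X in _ - X](bigID (fun i : 'I_N => (i < N - j)%N)) /= opprD addNKr.
apply/sordN/sord_sum => i; rewrite -leqNgt leq_subLR addnC => lei.
have ordX f l : sord 1 f -> sord l (f ^+ l).
  by move=> f1; have := @sordX _ _ 1 l _ f1; rewrite mul1n.
by apply: (sordW lei); apply: (@sordM _ _ i j); apply/sordMl/ordX.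
Qed.

Lemma sexp0 : sexp (0 : {series k[d]}) = 1.
Proof.
by rewrite sexpE spow_shift // mul0r addr0 fact0 invr1 rmorph1.
Qed.

Lemma sexpMn g j : sord 1 g -> sexp (g *+ j) = sexp g ^+ j.
Proof.
move=> g1; elim: j => [|j IHj]; first exact: sexp0.
rewrite mulrS exprS sexpD ?IHj // => m ltm.
by elim: j {IHj} => [|j IHj]; rewrite ?mulrS ?scoefD ?IHj ?g1 ?addr0.
Qed.

End Exp.

(** * Tensors and the contracted equation *)

Section TensLift.
Variables (R S : comNzRingType) (n : nat) (V : lmodType S).
Variable F : 'M[R]_n -> 'M[R]_n -> V.

Lemma tens_lift_is_linear : linear (tens_lift F).
Proof.
move=> c s t; rewrite /tens_lift.
do 4![rewrite scaler_sumr -big_split; apply: eq_bigr => ? _ /=].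
by rewrite !mxE scalerDl scalerA.
Qed.

HB.instance Definition _ := GRing.isLinear.Build S 'M[S]_(n * n) V *:%R
  (tens_lift F) tens_lift_is_linear.

End TensLift.

Section Tensors.
Variables (R : comNzRingType) (n : nat).
Local Notation idx := mxtens_index.
Implicit Types s t : 'M[R]_(n * n).

Lemma big_mxtens m p (V : nmodType) (F : 'I_(m * p) -> V) :
  \sum_i F i = \sum_i \sum_j F (idx (i, j)).
Proof.
rewrite pair_big (reindex (@mxtens_index m p)) /=.
  by apply: eq_bigr => -[].
by exists (@mxtens_unindex m p) => ? _; rewrite (mxtens_indexK, mxtens_unindexK).
Qed.

Lemma eq_mxtens m p (i j : 'I_m) (k l : 'I_p) :
  (idx (i, k) == idx (j, l)) = (i == j) && (k == l).
Proof. by rewrite (can_eq (@mxtens_indexK m p)) xpair_eqE. Qed.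

Lemma tens_deltaE (i j k l : 'I_n) :
  delta_mx i j *t delta_mx k l = delta_mx (idx (i, k)) (idx (j, l)) :> 'M[R]_(n * n).
Proof.
apply/matrixP=> p q; case: (mxtens_indexP p) => p1 p2.
case: (mxtens_indexP q) => q1 q2; rewrite tensmxE !mxE !eq_mxtens -natrM mulnb.
by rewrite andbACA.
Qed.

Lemma tens_sum_delta t :
  t = tens_lift (fun a b : 'M[R]_n => a *t b) t.
Proof.
rewrite {1}[t]matrix_sum_delta big_mxtens /tens_lift; apply: eq_bigr => i _.
under eq_bigr do rewrite big_mxtens.
rewrite exchange_big; apply: eq_bigr => j _; apply: eq_bigr => k _.
by apply: eq_bigr => l _; rewrite tens_deltaE.
Qed.

Lemma tens_ind (P : 'M[R]_(n * n) -> Prop) :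
    (forall c s t, P s -> P t -> P (c *: s + t)) -> P 0 ->
    (forall a b : 'M[R]_n, P (a *t b)) ->
  forall t, P t.
Proof.
move=> Plin P0 Pab t; rewrite [t]tens_sum_delta /tens_lift.
have PD u v : P u -> P v -> P (u + v) by move=> *; rewrite -[u]scale1r; apply: Plin.
do 4![apply: (big_ind P) => // ? _].
by rewrite -[X in P X]addr0; apply: Plin.
Qed.

Lemma tensmx_linearl m p (b : 'M[R]_p) :
  linear (fun a : 'M[R]_m => a *t b : 'M_(m * p)).
Proof.
move=> x u v /=; apply/matrixP=> i j.
case: (mxtens_indexP i) => i1 i2; case: (mxtens_indexP j) => j1 j2.
by rewrite !mxE mulrDl mulrA.
Qed.

Lemma tensmx_linearr m p (a : 'M[R]_m) :
  linear (fun b : 'M[R]_p => a *t b : 'M_(m * p)).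
Proof.
move=> x u v /=; apply/matrixP=> i j.
case: (mxtens_indexP i) => i1 i2; case: (mxtens_indexP j) => j1 j2.
by rewrite !mxE mulrDr mulrCA.
Qed.

HB.instance Definition _ :=
  GRing.isLinear.Build R 'M[R]_(n * n) 'M[R]_(n * n * n) *:%R
    (@leg12 R n) (tens_lift_is_linear _).
HB.instance Definition _ :=
  GRing.isLinear.Build R 'M[R]_(n * n) 'M[R]_(n * n * n) *:%R
    (@leg13 R n) (tens_lift_is_linear _).
HB.instance Definition _ :=
  GRing.isLinear.Build R 'M[R]_(n * n) 'M[R]_(n * n * n) *:%R
    (@leg23 R n) (tens_lift_is_linear _).

Lemma leg12_tens (a b : 'M[R]_n) : leg12 (a *t b) = a *t b *t (1%:M : 'M_n).
Proof.
rewrite /leg12 tens_liftE // => c x u v; first by rewrite tensmx_linearr tensmx_linearl.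
by rewrite tensmx_linearl tensmx_linearl.
Qed.

Lemma leg13_tens (a b : 'M[R]_n) : leg13 (a *t b) = a *t (1%:M : 'M_n) *t b.
Proof.
rewrite /leg13 tens_liftE // => c x u v; first by rewrite tensmx_linearr.
by rewrite tensmx_linearl tensmx_linearl.
Qed.

Lemma leg23_tens (a b : 'M[R]_n) : leg23 (a *t b) = (1%:M : 'M_n) *t a *t b.
Proof.
rewrite /leg23 tens_liftE // => c x u v; first by rewrite tensmx_linearr.
by rewrite tensmx_linearr tensmx_linearl.
Qed.

Lemma leg12E t i j k l p q :
  leg12 t (idx (idx (i, k), p)) (idx (idx (j, l), q))
  = t (idx (i, k)) (idx (j, l)) * (p == q)%:R.
Proof.
elim/tens_ind: t => [c s t IHs IHt||a b].
- by rewrite linearP !mxE IHs IHt mulrDl mulrA.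
- by rewrite linear0 !mxE mul0r.
- by rewrite leg12_tens tensmxE !mxE.
Qed.

Lemma leg13E t i j k l p q :
  leg13 t (idx (idx (i, k), p)) (idx (idx (j, l), q))
  = t (idx (i, p)) (idx (j, q)) * (k == l)%:R.
Proof.
elim/tens_ind: t => [c s t IHs IHt||a b].
- by rewrite linearP !mxE IHs IHt mulrDl mulrA.
- by rewrite linear0 !mxE mul0r.
- by rewrite leg13_tens !tensmxE !mxE mulrAC.
Qed.

Lemma leg23E t i j k l p q :
  leg23 t (idx (idx (i, k), p)) (idx (idx (j, l), q))
  = t (idx (k, p)) (idx (l, q)) * (i == j)%:R.
Proof.
elim/tens_ind: t => [c s t IHs IHt||a b].
- by rewrite linearP !mxE IHs IHt mulrDl mulrA.
- by rewrite linear0 !mxE mul0r.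
- by rewrite leg23_tens !tensmxE !mxE [X in X * _]mulrC mulrAC.
Qed.

(** These are the entries of the flip of V (x) V: the Casimir tensor swaps the two factors. *)
Lemma casimir_entry i j k l :
  casimir R n (idx (i, k)) (idx (j, l)) = ((l == i) && (k == j))%:R.
Proof.
rewrite /casimir summxE (bigD1 i) //= [X in _ + X]big1 ?addr0; last first.
  move=> a ne_a; rewrite summxE big1 // => b _; rewrite tensmxE !mxE.
  by rewrite [i == a]eq_sym (negPf ne_a) mul0r.
rewrite summxE (bigD1 j) //= [X in _ + X]big1 ?addr0; last first.
  move=> b ne_b; rewrite tensmxE !mxE [j == b]eq_sym (negPf ne_b) andbF.
  by rewrite mul0r.
by rewrite tensmxE !mxE !eqxx mul1r andbC.
Qed.

Lemma trace_casimir : \tr (casimir R n) = n%:R.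
Proof.
rewrite /mxtrace big_mxtens (eq_bigr (fun=> 1)) ?sumr_const ?card_ord // => i _.
rewrite (bigD1 i) //= casimir_entry eqxx big1 ?addr0 // => j /negPf nej.
by rewrite casimir_entry nej.
Qed.

Lemma sum_delta m (F : 'I_m -> R) i : \sum_j F j * (i == j)%:R = F i.
Proof.
rewrite (bigD1 i) //= eqxx mulr1 big1 ?addr0 // => j.
by rewrite eq_sym => /negPf->; rewrite mulr0.
Qed.

Lemma sum_delta2 m p (F : 'I_m -> 'I_p -> R) i j :
  \sum_a \sum_b F a b * ((i == a)%:R * (j == b)%:R) = F i j.
Proof.
rewrite -[RHS](sum_delta (F^~ j)); apply: eq_bigr => a _.
rewrite -(sum_delta (F a) j) mulr_suml; apply: eq_bigr => b _.
by rewrite mulrA mulrAC.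
Qed.

(** The A-CYBE for r^{ij} = T_ij / b_ij, multiplied by b12 b13 b23; each product of two factors
    keeps the denominator of the third. *)
Definition cleared_cybe (T12 T13 T23 : 'M[R]_(n * n)) (b12 b13 b23 : R) :=
  b23 *: (leg13 T13 *m leg12 T12) - b13 *: (leg12 T12 *m leg23 T23)
  + b12 *: (leg23 T23 *m leg13 T13).

Section Contraction.
Variables (T12 T13 T23 : 'M[R]_(n * n)) (b12 b13 b23 : R).
Hypothesis cybeT : cleared_cybe T12 T13 T23 b12 b13 b23 = 0.

Lemma cleared_cybe_entry i j k l p q :
  b23 * (\sum_a T13 (idx (i, p)) (idx (a, q)) * T12 (idx (a, k)) (idx (j, l)))
  - b13 * (\sum_a T12 (idx (i, k)) (idx (j, a)) * T23 (idx (a, p)) (idx (l, q)))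
  + b12 * (\sum_a T23 (idx (k, p)) (idx (l, a)) * T13 (idx (i, a)) (idx (j, q)))
  = 0.
Proof.
move/matrixP/(_ (idx (idx (i, k), p)) (idx (idx (j, l), q))): cybeT.
rewrite /cleared_cybe !mxE => cybeE; rewrite -[RHS]cybeE; congr (_ * _ - _ * _ + _ * _);
  rewrite !big_mxtens.
- apply: eq_bigr => a _; rewrite -(sum_delta2 (fun b c =>
    T13 (idx (i, p)) (idx (a, c)) * T12 (idx (a, b)) (idx (j, l))) k q).
  apply: eq_bigr => b _; apply: eq_bigr => c _.
  by rewrite leg13E leg12E [c == q]eq_sym mulrACA.
- rewrite exchange_big; apply: eq_bigr => b _ /=; rewrite -(sum_delta2 (fun a c =>
    T12 (idx (i, k)) (idx (a, b)) * T23 (idx (b, c)) (idx (l, q))) j p).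
  apply: eq_bigr => a _; apply: eq_bigr => c _.
  rewrite leg12E leg23E [a == j]eq_sym [RHS]mulrACA; congr (_ * _); exact: mulrC.
- under [RHS]eq_bigr do rewrite exchange_big.
  rewrite exchange_big; apply: eq_bigr => c _ /=; rewrite -(sum_delta2 (fun a b =>
    T23 (idx (k, p)) (idx (b, c)) * T13 (idx (a, c)) (idx (j, q))) i l).
  apply: eq_bigr => a _; apply: eq_bigr => b _.
  by rewrite leg23E leg13E [b == l]eq_sym mulrACA.
Qed.

(** The column index of leg 2 is set equal to the row index of leg 1 and summed. The third product
    then becomes an ordinary product in A (x) A, while the other two acquire, after renaming
    indices, the common factor T12. Their bracket vanishes on X_1 = X_2, where T13 = T23 and b13 =
    b23: this is the cancellation of the pole. *)
Lemma cleared_cybe_contract12 j k p q :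
  \sum_i \sum_a T12 (idx (a, k)) (idx (j, i)) *
     (b23 * T13 (idx (i, p)) (idx (a, q)) - b13 * T23 (idx (i, p)) (idx (a, q)))
  + b12 * (T23 *m T13) (idx (k, p)) (idx (j, q)) = 0.
Proof.
rewrite mxE big_mxtens.
rewrite [RHS](_ : 0 = \sum_(h < n) 0); last by rewrite big1_eq.
under [RHS]eq_bigr => i _ do rewrite -(cleared_cybe_entry i j k i p q).
rewrite big_split sumrB -!mulr_sumr; congr (_ + _).
have -> : \sum_i \sum_a T12 (idx (i, k)) (idx (j, a)) * T23 (idx (a, p)) (idx (i, q))
    = \sum_i \sum_a T12 (idx (a, k)) (idx (j, i)) * T23 (idx (i, p)) (idx (a, q)).
  exact: exchange_big.
rewrite !mulr_sumr -sumrB; apply: eq_bigr => i _.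
rewrite !mulr_sumr -sumrB; apply: eq_bigr => a _.
by ring.
Qed.

(** The mirror contraction, identifying the column index of leg 3 with the row index of leg 2: now
    the first product becomes an ordinary one, and the bracket vanishes on X_2 = X_3. *)
Lemma cleared_cybe_contract23 i j p l :
  b23 * (T13 *m T12) (idx (i, p)) (idx (j, l))
  + \sum_a \sum_k T23 (idx (a, p)) (idx (l, k)) *
     (b12 * T13 (idx (i, k)) (idx (j, a)) - b13 * T12 (idx (i, k)) (idx (j, a)))
  = 0.
Proof.
rewrite mxE big_mxtens exchange_big.
rewrite [RHS](_ : 0 = \sum_(h < n) 0); last by rewrite big1_eq.
under [RHS]eq_bigr => k _ do rewrite -(cleared_cybe_entry i j k l p k).
rewrite big_split /= sumrB -!mulr_sumr -addrA; congr (_ + _).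
have -> : \sum_k \sum_a T12 (idx (i, k)) (idx (j, a)) * T23 (idx (a, p)) (idx (l, k))
    = \sum_a \sum_k T12 (idx (i, k)) (idx (j, a)) * T23 (idx (a, p)) (idx (l, k)).
  exact: exchange_big.
rewrite !mulr_sumr addrC -sumrB; apply: eq_bigr => a _.
rewrite !mulr_sumr -sumrB; apply: eq_bigr => k _.
by ring.
Qed.

End Contraction.

End Tensors.

(** * The rational solutions *)

Section Euler.
Variables (k : fieldType).
Hypothesis char0 : [pchar k] =i pred0.
Implicit Types p q : {poly k}.

Definition euler p := 'X * p^`().

Lemma eulerM p q : euler (p * q) = euler p * q + p * euler q.
Proof. by rewrite /euler derivM; ring. Qed.

Lemma eulerXn a : euler 'X^a = a%:R * 'X^a.
Proof.
rewrite /euler derivXn; case: a => [|a]; first by rewrite mulr0n mulr0 mul0r.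
by rewrite mulrnAr -exprS mulr_natl.
Qed.

Lemma poly_order p : p != 0 -> exists a q, q.[0] != 0 /\ p = 'X^a * q.
Proof.
move=> nzp; have [a [q + ->]] := multiplicity_XsubC p 0.
by rewrite nzp /= subr0 => nzq; exists a, q; split; rewrite // mulrC.
Qed.

(* With [D = euler], the hypothesis says that [W / th ^ 2] is constant, where
   [D (d / th) = - W / th ^ 2]; comparing orders at 0 excludes a nonzero
   constant. *)
Lemma euler_wronskian_eq0 (th d : {poly k}) :
    let W := euler th * d - th * euler d in
  2%:R * W * euler th = th * euler W -> W = 0.
Proof.
set W := euler th * d - th * euler d => /= eqW.
have [//|nzW] := eqVneq W 0.
have nzth : th != 0.
  by apply: contra_neq nzW => th0; rewrite /W th0 /euler deriv0 mulr0 !mul0r subrr.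
have nzd : d != 0.
  by apply: contra_neq nzW => d0; rewrite /W d0 /euler deriv0 !mulr0 subrr.
have [a [th0 [nzth0 Eth]]] := poly_order nzth.
have [b [d0 [nzd0 Ed]]] := poly_order nzd.
have [c [w0 [nzw0 Ew]]] := poly_order nzW.
have Xn_neq0 l : 'X^l != 0 :> {poly k} by rewrite expf_neq0 ?polyX_eq0.
have natr_eq0 l : (l%:R == 0 :> k) = (l == 0)%N by move/pcharf0P: char0 => ->.
have natr_inj l l' : l%:R = l'%:R :> k -> l = l'.
  wlog le_ll' : l l' / (l <= l')%N.
    by move=> IH E; case/orP: (leq_total l l') => le; [|apply/esym]; apply: IH.
  move=> /eqP; rewrite eq_sym -subr_eq0 -natrB // natr_eq0 subn_eq0 => le_l'l.
  by apply/eqP; rewrite eqn_leq le_ll'.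
(* Both sides of the hypothesis are divisible by X^(a + c); the coefficients of that power are 2 a
   and c, times the same nonzero factor. *)
have c2a : c = (2 * a)%N.
  apply: natr_inj; apply: (mulIf (mulf_neq0 nzw0 nzth0)).
  have : 'X^(a + c) * (2%:R * w0 * (a%:R * th0 + euler th0)) =
         'X^(a + c) * (th0 * (c%:R * w0 + euler w0)).
    transitivity (2%:R * W * euler th).
      by rewrite Ew Eth eulerM eulerXn exprD; ring.
    by rewrite eqW Ew Eth eulerM eulerXn exprD; ring.
  move/(mulfI (Xn_neq0 _))/(congr1 (horner^~ 0)).
  rewrite !(hornerM, hornerD, hornerX, hornerMn, hornerC) !mul0r !addr0 => E.
  by rewrite natrM; transitivity (th0.[0] * (c%:R * w0.[0])); [|rewrite -E]; ring.
(* W has order exactly a + b if a != b, and order above a + b if a = b. In neither case can it be c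
   = 2 a. *)
pose G := (a%:R - b%:R) * (th0 * d0) + (euler th0 * d0 - th0 * euler d0).
have WE : W = 'X^(a + b) * G.
  by rewrite /W Eth Ed !eulerM !eulerXn exprD /G; ring.
have G0 : G.[0] = (a%:R - b%:R) * (th0.[0] * d0.[0]).
  by rewrite /G !(hornerM, hornerD, hornerN, hornerX, hornerMn, hornerC); ring.
case: (ltngtP a b) => [ltab|ltba|eqab].
- have : 'X^(a + a) * w0 = 'X^(a + a) * ('X^(b - a) * G).
    by rewrite mulrA -exprD -addnA subnKC 1?ltnW // -WE Ew c2a mul2n addnn.
  move/(mulfI (Xn_neq0 _))/(congr1 (horner^~ 0)) => E.
  case/eqP: nzw0; rewrite E hornerM hornerXn expr0n subn_eq0 leqNgt ltab.
  by rewrite mul0r.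
- have : 'X^(a + b) * ('X^(a - b) * w0) = 'X^(a + b) * G.
    by rewrite mulrA -exprD -WE Ew c2a mul2n -addnn -addnA subnKC // ltnW.
  move/(mulfI (Xn_neq0 _))/(congr1 (horner^~ 0)).
  rewrite G0 hornerM hornerXn expr0n subn_eq0 leqNgt ltba mul0r => /esym/eqP.
  rewrite !mulf_eq0 (negPf nzth0) (negPf nzd0) !orbF subr_eq0 => /eqP /natr_inj E.
  by rewrite E ltnn in ltba.
- case/eqP: nzw0; suff -> : w0 = G by rewrite G0 eqab subrr mul0r.
  apply: (mulfI (Xn_neq0 (a + b)%N)).
  by rewrite -WE Ew c2a eqab mul2n addnn.
Qed.

End Euler.

Section MapCybe.
Variables (R S : comNzRingType) (h : {rmorphism R -> S}) (n : nat).

Lemma map_leg12 (t : 'M[R]_(n * n)) : map_mx h (leg12 t) = leg12 (map_mx h t).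
Proof.
apply/matrixP=> P Q; case: (mxtens_indexP P) => P' p; case: (mxtens_indexP Q) => Q' q.
case: (mxtens_indexP P') => i j; case: (mxtens_indexP Q') => a b.
by rewrite mxE !leg12E mxE rmorphM rmorph_nat.
Qed.

Lemma map_leg13 (t : 'M[R]_(n * n)) : map_mx h (leg13 t) = leg13 (map_mx h t).
Proof.
apply/matrixP=> P Q; case: (mxtens_indexP P) => P' p; case: (mxtens_indexP Q) => Q' q.
case: (mxtens_indexP P') => i j; case: (mxtens_indexP Q') => a b.
by rewrite mxE !leg13E mxE rmorphM rmorph_nat.
Qed.

Lemma map_leg23 (t : 'M[R]_(n * n)) : map_mx h (leg23 t) = leg23 (map_mx h t).
Proof.
apply/matrixP=> P Q; case: (mxtens_indexP P) => P' p; case: (mxtens_indexP Q) => Q' q.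
case: (mxtens_indexP P') => i j; case: (mxtens_indexP Q') => a b.
by rewrite mxE !leg23E mxE rmorphM rmorph_nat.
Qed.

Lemma map_cleared_cybe T12 T13 T23 b12 b13 b23 :
  map_mx h (@cleared_cybe R n T12 T13 T23 b12 b13 b23) =
  cleared_cybe (map_mx h T12) (map_mx h T13) (map_mx h T23) (h b12) (h b13) (h b23).
Proof.
rewrite /cleared_cybe map_mxD map_mxB !map_mxZ !map_mxM.
by rewrite map_leg12 map_leg13 map_leg23.
Qed.

End MapCybe.

Lemma map_casimir (R S : comNzRingType) (h : {rmorphism R -> S}) n :
  map_mx h (casimir R n) = casimir S n.
Proof.
apply/matrixP=> P Q; case: (mxtens_indexP P) => i j; case: (mxtens_indexP Q) => a b.
by rewrite mxE !casimir_entry rmorph_nat.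
Qed.

(** * The trigonometric form with cleared denominators *)

Section Trigonometric.
Variables (k : comNzRingType) (n m M : nat).
Variables (gamma : 'I_m -> 'M[k]_(n * n)) (S : 'M[{mpoly k[2]}]_(n * n)).
Implicit Types A B : comNzRingType.

(* [trig_num x y / trig_den x y] is
   [y^m / (x^m - y^m) * \sum_j (x / y)^j gamma_j + S(x, y) / (x y)^M]. *)
Definition trig_num A (iota : k -> A) (x y : A) : 'M[A]_(n * n) :=
  (x * y) ^+ M *: (\sum_(j < m) (x ^+ j * y ^+ (m - j)) *: map_mx iota (gamma j))
  + (x ^+ m - y ^+ m) *: map_mx (mmap iota (tnth [tuple x; y])) S.

Definition trig_den A (x y : A) : A := (x ^+ m - y ^+ m) * (x * y) ^+ M.

(** The ring A is left open: the same expression is compared in three-variable polynomials, in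
    [{poly {poly k}}] and in power series. *)
Definition trig_cybe A (iota : k -> A) (x y z : A) :=
  cleared_cybe (trig_num iota x y) (trig_num iota x z) (trig_num iota y z)
    (trig_den x y) (trig_den x z) (trig_den y z).

Lemma map_trig_num A B (h : {rmorphism A -> B}) iota iota' x y :
    (forall c, h (iota c) = iota' c) ->
  map_mx h (trig_num iota x y) = trig_num iota' (h x) (h y).
Proof.
move=> hi; rewrite /trig_num map_mxD !map_mxZ rmorphB !rmorphXn rmorphM /=.
have hiM p q (c : 'M_(p, q)) : map_mx h (map_mx iota c) = map_mx iota' c.
  by apply/matrixP=> i j; rewrite !mxE hi.
congr (_ *: _ + _ *: _).
  rewrite raddf_sum; apply: eq_bigr => j _.
  by rewrite /= map_mxZ rmorphM !rmorphXn hiM.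
apply/matrixP=> i j; rewrite !mxE rmorph_mmap; apply: eq_mmap => [c|a] /=.
  exact: hi.
by case: a => -[|[|]].
Qed.

Lemma rmorph_trig_den A B (h : {rmorphism A -> B}) x y :
  h (trig_den x y) = trig_den (h x) (h y).
Proof. by rewrite /trig_den rmorphM rmorphB !rmorphXn rmorphM. Qed.

Lemma map_trig_cybe A B (h : {rmorphism A -> B}) iota iota' x y z :
    (forall c, h (iota c) = iota' c) ->
  map_mx h (trig_cybe iota x y z) = trig_cybe iota' (h x) (h y) (h z).
Proof.
move=> hi; rewrite /trig_cybe map_cleared_cybe !rmorph_trig_den.
by rewrite !(map_trig_num _ _ hi).
Qed.

Hypothesis sum_gamma : casimir k n = \sum_j gamma j.

(** On the diagonal the regular part is killed by x^m - y^m and all weights x^j y^(m - j) equal x^m,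
    so the residue sees the gamma_j only through their sum, the flip. *)
Lemma trig_num_diag A (iota : {rmorphism k -> A}) x :
  trig_num iota x x = (x ^+ m * (x * x) ^+ M) *: casimir A n.
Proof.
rewrite /trig_num subrr scale0r addr0 -(map_casimir iota) sum_gamma.
rewrite [_ * (x * x) ^+ M]mulrC -scalerA [in RHS]raddf_sum; congr (_ *: _).
rewrite scaler_sumr; apply: eq_bigr => j _.
by rewrite -exprD subnKC // ltnW.
Qed.

End Trigonometric.

Section DerivAt.
Variables (L : comNzRingType) (c : L).
Implicit Types p q : {poly L}.

(** The first-order term on the diagonal, when the moving variable is the outer ['X] of [{poly L}]
    and c is the variable it tends to. *)
Definition deriv_at p : L := p^`().[c].

Lemma deriv_at_is_additive : {morph deriv_at : p q / p - q}.
Proof. by move=> p q; rewrite /deriv_at derivB hornerD hornerN. Qed.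
HB.instance Definition _ :=
  GRing.isZmodMorphism.Build {poly L} L deriv_at deriv_at_is_additive.

Lemma deriv_atM p q : deriv_at (p * q) = deriv_at p * q.[c] + p.[c] * deriv_at q.
Proof. by rewrite /deriv_at derivM hornerD !hornerM. Qed.

Lemma deriv_atC x : deriv_at x%:P = 0.
Proof. by rewrite /deriv_at derivC horner0. Qed.

Lemma deriv_at_trig_den m M : deriv_at (trig_den m M 'X c%:P) =
  (c ^+ m.-1 *+ m) * (c * c) ^+ M.
Proof.
rewrite /trig_den deriv_atM raddfB /= -rmorphXn deriv_atC subr0.
rewrite !(hornerE, hornerXn) subrr mul0r addr0.
by rewrite /deriv_at derivXn hornerMn hornerXn.
Qed.
End DerivAt.

Lemma deriv_at_map (k : comNzRingType) (p : {poly k}) :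
  deriv_at 'X (map_poly polyC p) = p^`().
Proof. by rewrite /deriv_at deriv_map -/(comp_poly 'X _) comp_polyXr. Qed.

Lemma horner_map_polyC (k : comNzRingType) (p : {poly k}) :
  (map_poly polyC p).['X] = p.
Proof. by rewrite -/(comp_poly 'X _) comp_polyXr. Qed.

(** Since F vanishes at c, the Leibniz rule leaves only T(c) F'(c), and the flip shape of T(c) turns
    the double sum into a partial trace. The boolean b holds the condition on the two remaining
    indices. *)
Lemma deriv_at_residue (L : comNzRingType) (c : L) n (T F : 'I_n -> 'I_n -> {poly L})
    e (b : bool) :
    (forall i a, (T i a).[c] = e * ((i == a) && b)%:R) ->
    (forall i a, (F i a).[c] = 0) ->
  deriv_at c (\sum_i \sum_a T i a * F i a)
  = e * b%:R * \sum_i deriv_at c (F i i).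
Proof.
move=> Tc Fc; rewrite raddf_sum mulr_sumr; apply: eq_bigr => i _.
rewrite raddf_sum (bigD1 i) //= [X in _ + X]big1 ?addr0 => [|a nea].
  by rewrite deriv_atM Fc Tc eqxx mulr0 add0r.
by rewrite deriv_atM Fc Tc eq_sym (negPf nea) mulr0 mulr0 mul0r addr0.
Qed.

(** From A' A + A A' = phi', multiplied by A: by cyclicity of the trace both terms on the left have
    trace phi tr A', even though A and A' need not commute. *)
Lemma trace_sqr_scalar (k : comNzRingType) n (A : 'M[{poly k}]_n) phi :
  A *m A = phi%:M -> 2%:R * phi * (\tr A)^`() = phi^`() * \tr A.
Proof.
move=> AA; pose A' := map_mx deriv A.
have trA' : \tr A' = (\tr A)^`().
  by rewrite [RHS]raddf_sum; apply: eq_bigr => i _; rewrite mxE.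
have dAA : A' *m A + A *m A' = phi^`()%:M.
  transitivity (map_mx deriv (A *m A)).
    apply/matrixP=> i j; rewrite !mxE raddf_sum -big_split; apply: eq_bigr => l _.
    by rewrite /= derivM !mxE.
  by rewrite AA; apply/matrixP=> i j; rewrite !mxE derivMn.
have /(congr1 (fun B => \tr (B *m A))) := dAA.
rewrite mulmxDl raddfD /= [X in _ + X]mxtrace_mulC -mulmxA AA mulmxA AA.
by rewrite mul_mx_scalar !mul_scalar_mx !linearZ /= trA' => <-; ring.
Qed.

(** * The Riccati equation and the contradiction *)

Section NoTrigonometric.
Variables (k : fieldType) (n m M : nat).
Variables (gamma : 'I_m -> 'M[k]_(n * n)) (S : 'M[{mpoly k[2]}]_(n * n)).
Hypotheses (char0 : [pchar k] =i pred0) (n_gt0 : (0 < n)%N) (m_gt0 : (0 < m)%N).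
Hypothesis sum_gamma : casimir k n = \sum_j gamma j.
Hypothesis cybe_S :
  trig_cybe M gamma S (fun c => c%:MP) 'X_0 'X_1 'X_2%:R = 0 :> 'M[{mpoly k[3]}]_(n * n * n).

Local Notation idx := mxtens_index.
Local Notation L := {poly k}.
Local Notation X := ('X : L).

Definition num1 : 'M[L]_(n * n) := trig_num M gamma S polyC 'X 1.
Definition den1 : L := trig_den m M 'X 1.
Local Notation R := num1.
Local Notation d := den1.

(** The polynomial identity in three independent variables is universal, hence holds at any point of
    any commutative k-algebra. *)
Lemma trig_cybe_at (A : comNzRingType) (iota : {rmorphism k -> A}) (x y z : A) :
  trig_cybe M gamma S iota x y z = 0.
Proof.
pose h : {rmorphism {mpoly k[3]} -> A} := mmap iota (tnth [tuple x; y; z]).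
have hX (i : 'I_3) : h 'X_i = tnth [tuple x; y; z] i.
  by rewrite /h /= mmapX mmap1U.
have hi c : h c%:MP = iota c by apply: mmapC.
move/(congr1 (map_mx h)): cybe_S; rewrite map_mx0 => E.
by move: E; rewrite (@map_trig_cybe _ _ _ _ _ _ _ _ h _ iota _ _ _ hi) !hX.
Qed.

Definition sqr1 := R *m R.

(** The contraction in legs 1, 2 at (X_1, X, 1), differentiated in X_1 at X_1 = X. The bracket
    contributes d R' - d' R, which is d^2 times the derivative of R / d, and the simple zero of the
    denominator contributes the factor of R^2. *)
Lemma sqr1_left k' p q j (e := X ^+ m * (X * X) ^+ M) :
  e * (k' == j)%:R * (\sum_i (d * (R (idx (i, p)) (idx (i, q)))^`() -
     d^`() * R (idx (i, p)) (idx (i, q))))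
  + (X ^+ m.-1 *+ m) * (X * X) ^+ M * sqr1 (idx (k', p)) (idx (j, q)) = 0.
Proof.
pose iota : {rmorphism k -> {poly L}} := polyC \o polyC.
have := cleared_cybe_contract12 (trig_cybe_at iota 'X X%:P 1) j k' p q.
set T12 := trig_num _ _ _ _ 'X X%:P; set T13 := trig_num _ _ _ _ 'X 1.
set T23 := trig_num _ _ _ _ X%:P 1.
have T13E : T13 = map_mx (map_poly polyC) R.
  rewrite (@map_trig_num _ _ _ _ _ _ _ _ _ _ iota) /= ?map_polyX ?rmorph1 // => c.
  exact: map_polyC.
have T23E : T23 = map_mx polyC R.
  by rewrite (@map_trig_num _ _ _ _ _ _ _ _ _ _ iota) ?rmorph1.
have T12E : map_mx (horner_eval X) T12 = e *: casimir L n.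
  rewrite (@map_trig_num _ _ _ _ _ _ _ _ _ _ (polyC)) => [|c]; last first.
    exact: hornerC.
  by rewrite /= /horner_eval hornerX hornerC (trig_num_diag _ _ sum_gamma).
have b13E : trig_den m M 'X 1 = map_poly polyC d.
  by rewrite rmorph_trig_den /= map_polyX rmorph1.
have b23E : trig_den m M X%:P 1 = d%:P by rewrite rmorph_trig_den rmorph1.
move/(congr1 (deriv_at X)); rewrite raddf0 raddfD /= => E0; rewrite -[RHS]E0.
rewrite deriv_atM deriv_at_trig_den [(trig_den _ _ _ _).[_]](_ : _ = 0); last first.
  by rewrite /trig_den !hornerE subrr mul0r.
rewrite mul0r addr0; congr (_ + _ * _).
  rewrite (@deriv_at_residue _ _ _ _ _ e (k' == j)).
  - congr (_ * _); apply: eq_bigr => a _.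
    rewrite b13E b23E T13E T23E !mxE raddfB /= !deriv_atM !deriv_atC.
    by rewrite !deriv_at_map !hornerC mul0r mulr0 add0r addr0.
  - move=> a b; have /matrixP/(_ (idx (b, k')) (idx (j, a))) := T12E.
    by rewrite !mxE casimir_entry.
  - move=> a b; rewrite b13E b23E T13E T23E !mxE !hornerE !horner_map_polyC.
    by rewrite subrr.
rewrite -/(horner_eval X _) T13E T23E.
have := map_mxM (horner_eval X) (map_mx polyC R) (map_mx (map_poly polyC) R).
move/matrixP/(_ (idx (k', p)) (idx (j, q))); rewrite [LHS]mxE => ->.
congr ((_ *m _) _ _); apply/matrixP=> a b.
  by rewrite [RHS]mxE [X in _ = _ X]mxE; apply/esym/hornerC.
by rewrite [RHS]mxE [X in _ = _ X]mxE; apply/esym/horner_map_polyC.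
Qed.

(** The contraction in legs 2, 3 at (X, X_2, 1), differentiated at X_2 = 1. Only the shape c (x) 1
    of R^2 matters later, so H is left existential. *)
Lemma sqr1_right i j : exists H, forall p l,
  m%:R * sqr1 (idx (i, p)) (idx (j, l)) = (p == l)%:R * H.
Proof.
pose iota : {rmorphism k -> {poly L}} := polyC \o polyC.
have := cleared_cybe_contract23 (trig_cybe_at iota X%:P 'X 1) i j.
set T12 := trig_num _ _ _ _ X%:P 'X; set T13 := trig_num _ _ _ _ X%:P 1.
set T23 := trig_num _ _ _ _ 'X 1.
have T13E : T13 = map_mx polyC R.
  by rewrite (@map_trig_num _ _ _ _ _ _ _ _ _ _ iota) ?rmorph1.
have T12E : map_mx (horner_eval 1) T12 = R.
  rewrite (@map_trig_num _ _ _ _ _ _ _ _ _ _ (polyC)) => [|c].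
    by rewrite /= /horner_eval hornerX hornerC.
  exact: hornerC.
have T23E : map_mx (horner_eval 1) T23 = casimir L n.
  rewrite (@map_trig_num _ _ _ _ _ _ _ _ _ _ (polyC)) => [|c].
    rewrite /= /horner_eval hornerX hornerC (trig_num_diag _ _ sum_gamma).
    by rewrite mulr1 !expr1n mulr1 scale1r.
  exact: hornerC.
have b13E : trig_den m M X%:P 1 = d%:P by rewrite rmorph_trig_den rmorph1.
have b12E : (trig_den m M X%:P 'X).[1] = d.
  rewrite -/(horner_eval 1 _) rmorph_trig_den.
  by rewrite /= /horner_eval hornerX hornerC.
move=> cybe1; exists (- (\sum_a deriv_at 1
  (trig_den m M X%:P 'X * T13 (idx (i, a)) (idx (j, a)) -
  trig_den m M X%:P 1 * T12 (idx (i, a)) (idx (j, a))))) => p l.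
have := cybe1 p l; move/(congr1 (deriv_at 1)); rewrite raddf0 raddfD /=.
rewrite (@deriv_at_residue _ _ _ _ _ 1 (p == l)); first 1 last.
- move=> a b; have /matrixP/(_ (idx (a, p)) (idx (l, b))) := T23E.
  by rewrite [LHS]mxE casimir_entry mul1r [b == a]eq_sym.
- move=> a b; rewrite hornerD hornerN (hornerM (trig_den m M X%:P 'X)).
  rewrite (hornerM (trig_den m M X%:P 1)) b12E b13E T13E [map_mx _ _ _ _]mxE.
  rewrite !hornerC; have /matrixP/(_ (idx (i, b)) (idx (j, a))) := T12E.
  by rewrite [LHS]mxE /horner_eval => ->; rewrite subrr.
rewrite -(rmorph1 (@polyC L)) deriv_atM deriv_at_trig_den.
rewrite [(trig_den _ _ _ _).[_]](_ : _ = 0); last first.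
  by rewrite /trig_den !hornerE subrr mul0r.
rewrite mul0r addr0 !(mul1r, mulr1) !expr1n !(mul1r, mulr1) => /eqP.
rewrite addr_eq0 => /eqP E.
rewrite mulrN -[RHS]E -/(horner_eval 1 _); congr (_ * _).
have := map_mxM (horner_eval 1) T13 T12.
move/matrixP/(_ (idx (i, p)) (idx (j, l))); rewrite [LHS]mxE => ->.
rewrite T12E; congr ((_ *m _) _ _); apply/matrixP=> a b.
by rewrite T13E [RHS]mxE [X in _ = _ X]mxE; apply/esym/hornerC.
Qed.

Lemma no_trig_cybe : False.
Proof.
have natr_eq0 (l : nat) : (l%:R == 0 :> k) = (l == 0)%N by move/pcharf0P: char0 => ->.
have e_neq0 a b : X ^+ a * (X * X) ^+ b != 0.
  by rewrite mulf_neq0 ?expf_neq0 ?mulf_neq0 ?polyX_eq0.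
pose i0 := Ordinal n_gt0; pose phi := sqr1 (idx (i0, i0)) (idx (i0, i0)).
pose G p q : L := \sum_i (d * (R (idx (i, p)) (idx (i, q)))^`() -
     d^`() * R (idx (i, p)) (idx (i, q))).
have leftE k' p q j :
    m%:R * sqr1 (idx (k', p)) (idx (j, q)) = - ((k' == j)%:R * ('X * G p q)).
  apply: (mulfI (e_neq0 m.-1 M)); apply/eqP; rewrite -subr_eq0; apply/eqP.
  rewrite -[RHS](sqr1_left k' p q j) -/(G p q).
  have -> : X ^+ m = X * X ^+ m.-1 by rewrite -exprS prednK.
  by rewrite -[X ^+ _ *+ m]mulr_natl; ring.
have m_inj : injective ( *%R (m%:R : L)).
  by apply: mulfI; rewrite -polyC_natr polyC_eq0 natr_eq0 -lt0n.
(* [leftE] places R^2 in 1 (x) A and [sqr1_right] places it in A (x) 1; the two subalgebras meet in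
   the scalars. The first reduces every diagonal block to the block [i0]. *)
have sqrE : R *m R = phi%:M.
  apply/matrixP=> P Q; case: (mxtens_indexP P) => i p.
  case: (mxtens_indexP Q) => j q; rewrite [RHS]mxE eq_mxtens -/sqr1.
  apply: m_inj; have [H HE] := sqr1_right i0 i0.
  have [<-|neij] := eqVneq i j; last first.
    by rewrite leftE (negPf neij) mul0r oppr0 mulr0.
  transitivity (m%:R * sqr1 (idx (i0, p)) (idx (i0, q))); first by rewrite !leftE !eqxx.
  rewrite HE; case: eqVneq => _; last by rewrite mul0r mulr0.
  by rewrite /phi mulr1n HE eqxx.
pose th := \tr R; pose W := euler th * d - th * euler d.
(* Taking the trace of the Riccati equation over the second leg: the scalar phi counts n times. *)
have WE : (m * n)%:R * phi = - W.
  rewrite natrM -mulrA [n%:R * _]mulr_natl mulrC mulrnAl mulrC.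
  transitivity (\sum_(p < n) - ('X * G p p)).
    rewrite -[X in _ *+ X]card_ord -sumr_const; apply: eq_bigr => p _.
    have /matrixP/(_ (idx (i0, p)) (idx (i0, p))) := sqrE.
    by rewrite [RHS]mxE eqxx mulr1n => <-; rewrite leftE eqxx mul1r.
  rewrite sumrN -mulr_sumr; congr (- _).
  have -> : \sum_p G p p = d * th^`() - d^`() * th.
    rewrite exchange_big /th /mxtrace big_mxtens raddf_sum !mulr_sumr -sumrB.
    apply: eq_bigr => i _; rewrite /= raddf_sum !mulr_sumr -sumrB.
    by apply: eq_bigr.
  by rewrite /W /euler; ring.
have W0 : W = 0.
  apply: (euler_wronskian_eq0 char0); rewrite -/W.
  have := trace_sqr_scalar sqrE; rewrite -/th => E.
  have -> : W = - (phi *+ (m * n)) by rewrite -mulr_natl WE opprK.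
  rewrite /euler derivN derivMn -[phi *+ _]mulr_natl -[_^`() *+ _]mulr_natl.
  transitivity (- ((m * n)%:R * 'X) * (2%:R * phi * th^`())); first by ring.
  by rewrite E; ring.
(* At X = 1 the numerator is the flip, of trace n, while d has a simple zero there with derivative
   m. Hence W(1) = - n m, against W = 0. *)
have th1 : th.[1] = n%:R.
  have <- : \tr (map_mx (horner_eval 1) R) = th.[1].
    by rewrite -/(horner_eval 1 _) raddf_sum; apply: eq_bigr => i _; rewrite mxE.
  rewrite (@map_trig_num _ _ _ _ _ _ _ _ _ _ idfun) => [|c]; last exact: hornerC.
  rewrite /= /horner_eval hornerX hornerC.
  by rewrite (trig_num_diag _ _ sum_gamma) mulr1 !expr1n mulr1 scale1r trace_casimir.
have d1 : d.[1] = 0 by rewrite /den1 /trig_den !hornerE subrr mul0r.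
have : W.[1] = - (n%:R * m%:R).
  have E (t u : L) : (euler t * u - t * euler u).[1] = t^`().[1] * u.[1] - t.[1] * u^`().[1].
    by rewrite /euler hornerD hornerN !hornerM hornerX !mul1r.
  rewrite E d1 mulr0 add0r th1 -/(deriv_at 1 d) /den1 -(rmorph1 polyC).
  by rewrite deriv_at_trig_den mulr1 !expr1n mulr1.
rewrite W0 horner0 => /esym/eqP; rewrite oppr_eq0 mulf_eq0 !natr_eq0.
by rewrite !gtn_eqF.
Qed.

End NoTrigonometric.

(** * Invariance under equivalence *)

Section MatrixUnits.
Variables (D : idomainType) (n : nat) (phi : 'M[D]_n -> 'M[D]_n).
Hypotheses (n_gt0 : (0 < n)%N) (aut_phi : alg_aut phi).

Lemma delta_sandwich (A : 'M[D]_n) (i a b j : 'I_n) :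
  delta_mx i a *m A *m delta_mx b j = A a b *: delta_mx i j.
Proof.
apply/matrixP=> p q; rewrite !mxE (bigD1 b) //= big1 ?addr0 => [|r ne_r].
  rewrite !mxE (bigD1 a) //= big1 ?addr0 => [|r ne_r].
    rewrite !mxE !eqxx andbT /=; case: (p == i); case: (q == j);
      by rewrite ?(mulr1n, mulr0n) ?(mulr1, mulr0, mul1r, mul0r).
  by rewrite !mxE (negPf ne_r) andbF mul0r.
by rewrite [delta_mx b j _ _]mxE (negPf ne_r) mulr0.
Qed.

(* Noether-Skolem up to a scalar, which avoids inverting [e]. *)
Lemma alg_aut_conj : exists (G G' : 'M[D]_n) (e : D),
  [/\ e != 0, G' *m G = e%:M
    & forall i j, e *: phi (delta_mx i j) = G *m delta_mx i j *m G'].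
Proof.
case: aut_phi => bij_phi lin_phi phi1 phiM.
pose phiL : {linear 'M[D]_n -> 'M[D]_n} :=
  HB.pack phi (GRing.isLinear.Build _ _ _ _ phi lin_phi).
pose E i j := phi (delta_mx i j); pose i0 := Ordinal n_gt0.
have EE i j l h : E i j *m E l h = E i h *+ (j == l).
  rewrite /E -phiM mul_delta_mx_cond; case: (j == l) => //.
  by rewrite mulr0n; apply: (linear0 phiL).
have : E i0 i0 != 0.
  apply/eqP => E0; have : delta_mx i0 i0 = 0 :> 'M[D]_n.
    by apply: (bij_inj bij_phi); rewrite [RHS](linear0 phiL).
  by move/matrixP/(_ i0 i0)/eqP; rewrite !mxE !eqxx oner_eq0.
(* The image of a matrix unit is nonzero, so some entry e of it is. Sandwiching that entry between
   matrix units gives G' G = e, and e serves as a common denominator. *)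
case/matrix0Pn => a [b nze]; set e := E i0 i0 a b in nze.
pose G := \sum_i E i i0 *m delta_mx b i.
pose G' := \sum_i delta_mx i a *m E i0 i.
have G'G : G' *m G = e%:M.
  rewrite scalar_mx_sum_delta mulmx_suml; apply: eq_bigr => i _.
  rewrite mulmx_sumr (bigD1 i) //= big1 ?addr0 => [|j ne_j];
    rewrite !mulmxA -(mulmxA (delta_mx i a)) EE.
    by rewrite eqxx mulr1n delta_sandwich.
  by rewrite eq_sym (negPf ne_j) mulr0n mulmx0 mul0mx.
have EG i j : E i j *m G = G *m delta_mx i j.
  transitivity (E i i0 *m delta_mx b j).
    rewrite mulmx_sumr (bigD1 j) //= big1 ?addr0 => [|l ne_l]; rewrite mulmxA EE.
      by rewrite eqxx.
    by rewrite eq_sym (negPf ne_l) mulr0n mul0mx.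
  rewrite mulmx_suml (bigD1 i) //= big1 ?addr0 => [|l ne_l].
    by rewrite -mulmxA mul_delta_mx.
  by rewrite -mulmxA mul_delta_mx_0 ?mulmx0.
(* A one-sided inverse up to e is two-sided: G has nonzero determinant over a domain, so it can be
   cancelled through its adjugate. *)
have GG' : G *m G' = e%:M.
  have detG : \det G != 0.
    apply: contra_eq_neq (congr1 determinant G'G) => detG0.
    by rewrite det_mulmx detG0 mulr0 det_scalar eq_sym expf_neq0.
  apply/eqP; rewrite -subr_eq0; set B := _ - _.
  have BG : B *m G = 0.
    by rewrite mulmxBl -mulmxA G'G mul_mx_scalar mul_scalar_mx subrr.
  have /eqP := congr1 (mulmx^~ (\adj G)) BG.
  by rewrite /= -mulmxA mul_mx_adj mul0mx mul_mx_scalar scalemx_eq0 (negPf detG).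
exists G, G', e; split=> // i j.
by rewrite -EG -mulmxA GG' mul_mx_scalar.
Qed.

End MatrixUnits.

Section Conjugation.
Variables (R : comNzRingType) (n : nat).
Variables (G1 G2 G3 G1' G2' G3' : 'M[R]_n) (e1 e2 e3 : R).
Hypotheses (G1K : G1' *m G1 = e1%:M) (G2K : G2' *m G2 = e2%:M)
  (G3K : G3' *m G3 = e3%:M).

Definition tens_conj (A A' B B' : 'M[R]_n) (t : 'M[R]_(n * n)) :=
  (A *t B) *m t *m (A' *t B').

Lemma tens_conj_is_linear A A' B B' : linear (tens_conj A A' B B').
Proof. by move=> c s t; rewrite /tens_conj mulmxDr mulmxDl -!(scalemxAr, scalemxAl). Qed.

HB.instance Definition _ A A' B B' := GRing.isLinear.Build R _ _ *:%R
  (tens_conj A A' B B') (tens_conj_is_linear A A' B B').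

Lemma tens_conj_tens A A' B B' a b :
  tens_conj A A' B B' (a *t b) = (A *m a *m A') *t (B *m b *m B').
Proof. by rewrite /tens_conj !tensmx_mul. Qed.

Let H := G1 *t G2 *t G3.
Let H' := G1' *t G2' *t G3'.

Lemma tensmxZl m p c (a : 'M[R]_m) (b : 'M[R]_p) : (c *: a) *t b = c *: (a *t b).
Proof. by rewrite -[c *: a]addr0 tensmx_linearl tens0mx addr0. Qed.

Lemma tensmxZr m p c (a : 'M[R]_m) (b : 'M[R]_p) : a *t (c *: b) = c *: (a *t b).
Proof. by rewrite -[c *: b]addr0 tensmx_linearr tensmx0 addr0. Qed.

Lemma conj_legs (l l' : {linear 'M[R]_(n * n) -> 'M[R]_(n * n * n)})
    (c c' : {linear 'M[R]_(n * n) -> 'M[R]_(n * n)}) e :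
    (forall a b a' b' : 'M_n, l (c (a *t b)) *m l' (c' (a' *t b'))
       = e *: (H *m (l (a *t b) *m l' (a' *t b')) *m H')) ->
  forall s t, l (c s) *m l' (c' t) = e *: (H *m (l s *m l' t) *m H').
Proof.
move=> ll' s t; elim/tens_ind: s => [x s s' IHs IHs'||a b].
- rewrite !linearP /= !(mulmxDl, mulmxDr) -!(scalemxAl, scalemxAr) IHs IHs'.
  by rewrite scalerDr !scalerA mulrC.
- by rewrite !linear0 !mul0mx mulmx0 mul0mx scaler0.
elim/tens_ind: t => [x s t IHs IHt||a' b'] //.
- rewrite !linearP /= !(mulmxDl, mulmxDr) -!(scalemxAl, scalemxAr) IHs IHt.
  by rewrite scalerDr !scalerA mulrC.
- by rewrite !linear0 !(mulmx0, mul0mx) scaler0.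
Qed.

(** In each product the two tensors share exactly one leg, where G_i' G_i collapses to e_i; the
    cleared denominator supplies the other two e's. All three terms thus carry the same factor e1 e2
    e3. *)
Lemma cleared_cybe_conj T12 T13 T23 b12 b13 b23 :
  cleared_cybe (tens_conj G1 G1' G2 G2' T12) (tens_conj G1 G1' G3 G3' T13)
    (tens_conj G2 G2' G3 G3' T23) (b12 * (e1 * e2)) (b13 * (e1 * e3))
    (b23 * (e2 * e3))
  = (e1 * e2 * e3) *: (H *m cleared_cybe T12 T13 T23 b12 b13 b23 *m H').
Proof.
have sandwich (A A' B B' x : 'M[R]_n) e : A' *m A = e%:M ->
    A *m x *m A' *m (A *m B *m B') = e *: (A *m (x *m B) *m B').
  move=> AK; rewrite !mulmxA -(mulmxA (A *m x)) AK mul_mx_scalar.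
  by rewrite -!scalemxAl.
rewrite /cleared_cybe (@conj_legs (@leg13 R n) (@leg12 R n) _ _ e1); last first.
  move=> a b c d; rewrite /= !tens_conj_tens !leg13_tens !leg12_tens !tensmx_mul.
  by rewrite (sandwich _ _ _ _ _ _ G1K) !tensmxZl !(mulmx1, mul1mx).
rewrite (@conj_legs (@leg12 R n) (@leg23 R n) _ _ e2); last first.
  move=> a b c d; rewrite /= !tens_conj_tens !leg23_tens !leg12_tens !tensmx_mul.
  by rewrite (sandwich _ _ _ _ _ _ G2K) tensmxZr tensmxZl !(mulmx1, mul1mx).
rewrite (@conj_legs (@leg23 R n) (@leg13 R n) _ _ e3); last first.
  move=> a b c d; rewrite /= !tens_conj_tens !leg23_tens !leg13_tens !tensmx_mul.
  by rewrite (sandwich _ _ _ _ _ _ G3K) tensmxZr !(mulmx1, mul1mx).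
rewrite !scalerA !(mulmxDl, mulmxDr, mulNmx, mulmxN) -!(scalemxAl, scalemxAr).
rewrite !(scalerDr, scalerN) !scalerA; congr (_ *: _ - _ *: _ + _ *: _); ring.
Qed.

End Conjugation.

Lemma cleared_cybeZ (R : comNzRingType) n (T12 T13 T23 : 'M[R]_(n * n))
    b12 b13 b23 c12 c13 c23 :
  cleared_cybe (c12 *: T12) (c13 *: T13) (c23 *: T23)
    (c12 * b12) (c13 * b13) (c23 * b23)
  = (c12 * c13 * c23) *: cleared_cybe T12 T13 T23 b12 b13 b23.
Proof.
rewrite /cleared_cybe !linearZ /= -!(scalemxAl, scalemxAr) !(scalerDr, scalerN).
by rewrite !scalerA; congr (_ *: _ - _ *: _ + _ *: _); ring.
Qed.

Lemma tens_lift_conj (R S : comNzRingType) n (F F' : 'M[R]_n -> 'M[S]_n)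
    (A A' B B' : 'M[S]_n) c c' t :
    (forall i j, c *: F (delta_mx i j) = A *m delta_mx i j *m A') ->
    (forall i j, c' *: F' (delta_mx i j) = B *m delta_mx i j *m B') ->
  (c * c') *: tens_lift (fun a b => F a *t F' b) t = tens_conj A A' B B' t.
Proof.
move=> FE F'E; rewrite [in RHS](tens_sum_delta t) /tens_lift.
do 4![rewrite [in RHS]raddf_sum scaler_sumr; apply: eq_bigr => ? _].
rewrite /= [in RHS]linearZ /= tens_conj_tens -FE -F'E tensmxZl tensmxZr !scalerA.
by congr (_ *: _); ring.
Qed.

Lemma sord_tuple1 (R : comNzRingType) d (w : {series R[d]}) :
  sord 1 w -> forall i, sord 1 (tnth [tuple w] i).
Proof. by move=> w1 i; rewrite [i]ord1. Qed.

Lemma sord_tuple2 (R : comNzRingType) d (w w' : {series R[d]}) :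
  sord 1 w -> sord 1 w' -> forall i, sord 1 (tnth [tuple w; w'] i).
Proof. by move=> w1 w'1 [[|[|]]]. Qed.

Lemma sord_tuple3 (R : comNzRingType) d (w w' w'' : {series R[d]}) :
  sord 1 w -> sord 1 w' -> sord 1 w'' -> forall i, sord 1 (tnth [tuple w; w'; w''] i).
Proof. by move=> w1 w'1 w''1 [[|[|[|]]]]. Qed.

Lemma cleared_cybe1 (R : comNzRingType) n (T12 T13 T23 : 'M[R]_(n * n)) :
  cleared_cybe T12 T13 T23 1 1 1 =
  leg13 T13 *m leg12 T12 - leg12 T12 *m leg23 T23 + leg23 T23 *m leg13 T13.
Proof. by rewrite /cleared_cybe !scale1r. Qed.

(** * The cleared equation for one tensor placed in three pairs of legs *)

Section Legs.
Variables (n : nat) (D E : idomainType) (h12 h13 h23 : {rmorphism D -> E}).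
Hypotheses (h12_inj : forall u, h12 u = 0 -> u = 0)
  (h13_inj : forall u, h13 u = 0 -> u = 0) (h23_inj : forall u, h23 u = 0 -> u = 0).
Implicit Types (T : 'M[D]_(n * n)) (b : D).

Definition legs_cybe T b :=
  cleared_cybe (map_mx h12 T) (map_mx h13 T) (map_mx h23 T) (h12 b) (h13 b) (h23 b).

Lemma legs_cybeZ c T b :
  legs_cybe (c *: T) (c * b) = (h12 c * h13 c * h23 c) *: legs_cybe T b.
Proof. by rewrite /legs_cybe !rmorphM !map_mxZ cleared_cybeZ. Qed.

(** The vanishing depends only on the fraction T / b: both pairs rescale to the same one by
    cross-multiplication, and the scaling factor cancels because the embeddings are injective. *)
Lemma legs_cybe_eq T T' b b' : b' != 0 ->
  b' *: T = b *: T' -> legs_cybe T' b' = 0 -> legs_cybe T b = 0.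
Proof.
move=> nzb' E' legs'.
have nzh (h : {rmorphism D -> E}) : (forall u, h u = 0 -> u = 0) -> h b' != 0.
  by move=> h_inj; apply: contra_neq nzb' => /h_inj.
have := legs_cybeZ b' T b; rewrite E' mulrC legs_cybeZ legs' scaler0.
move/esym/eqP; rewrite scalemx_eq0 !mulf_eq0.
by rewrite (negPf (nzh _ h12_inj)) (negPf (nzh _ h13_inj)) (negPf (nzh _ h23_inj)) => /eqP.
Qed.

Lemma map_legs_cybe (c2 : {rmorphism D -> D}) (c3 : {rmorphism E -> E}) T b :
    (forall u, c3 (h12 u) = h12 (c2 u)) -> (forall u, c3 (h13 u) = h13 (c2 u)) ->
    (forall u, c3 (h23 u) = h23 (c2 u)) ->
  map_mx c3 (legs_cybe T b) = legs_cybe (map_mx c2 T) (c2 b).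
Proof.
have mapE (h : {rmorphism D -> E}) : (forall u, c3 (h u) = h (c2 u)) ->
    map_mx c3 (map_mx h T) = map_mx h (map_mx c2 T).
  by move=> ch; apply/matrixP=> i j; rewrite !mxE ch.
move=> c12 c13 c23; rewrite /legs_cybe map_cleared_cybe c12 c13 c23.
by rewrite (mapE _ c12) (mapE _ c13) (mapE _ c23).
Qed.

Lemma legs_cybe_conj (C : idomainType) (a0 a1 : {rmorphism C -> D})
    (b1 b2 b3 : {rmorphism C -> E}) (G G' : 'M[C]_n) e T b :
    (forall u, h12 (a0 u) = b1 u) -> (forall u, h12 (a1 u) = b2 u) ->
    (forall u, h13 (a0 u) = b1 u) -> (forall u, h13 (a1 u) = b3 u) ->
    (forall u, h23 (a0 u) = b2 u) -> (forall u, h23 (a1 u) = b3 u) ->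
    G' *m G = e%:M -> legs_cybe T b = 0 ->
  legs_cybe (tens_conj (map_mx a0 G) (map_mx a0 G') (map_mx a1 G) (map_mx a1 G') T)
    (b * (a0 e * a1 e)) = 0.
Proof.
move=> ha12 hb12 ha13 hb13 ha23 hb23 G'G cybeT.
have mapE (h : {rmorphism D -> E}) (c c' : {rmorphism C -> E}) :
    (forall u, h (a0 u) = c u) -> (forall u, h (a1 u) = c' u) ->
    map_mx h (tens_conj (map_mx a0 G) (map_mx a0 G') (map_mx a1 G) (map_mx a1 G') T)
    = tens_conj (map_mx c G) (map_mx c G') (map_mx c' G) (map_mx c' G') (map_mx h T).
  move=> ha hb; rewrite /tens_conj !map_mxM !map_mxT.
  have haM (X : 'M[C]_n) : map_mx h (map_mx a0 X) = map_mx c X.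
    by apply/matrixP=> i j; rewrite !mxE ha.
  have hbM (X : 'M[C]_n) : map_mx h (map_mx a1 X) = map_mx c' X.
    by apply/matrixP=> i j; rewrite !mxE hb.
  by rewrite !haM !hbM.
rewrite /legs_cybe (mapE _ _ _ ha12 hb12) (mapE _ _ _ ha13 hb13) (mapE _ _ _ ha23 hb23).
rewrite !rmorphM ha12 hb12 ha13 hb13 ha23 hb23.
have bK (h : {rmorphism C -> E}) : map_mx h G' *m map_mx h G = (h e)%:M.
  by rewrite -map_mxM G'G map_scalar_mx.
rewrite (cleared_cybe_conj (bK b1) (bK b2) (bK b3)) -/(legs_cybe T b) cybeT.
by rewrite mulmx0 mul0mx scaler0.
Qed.

End Legs.

Section Fractions.
Variable n : nat.

Definition frac_mx (D : idomainType) (T : 'M[D]_(n * n)) (b : D) :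
  'M[{fraction D}]_(n * n) := map_mx (fun c => c%:F / b%:F) T.

Lemma frac_mxE (D : idomainType) (T : 'M[D]_(n * n)) b :
  frac_mx T b = (b%:F)^-1 *: map_mx (@FracField.tofrac D) T.
Proof. by apply/matrixP=> i j; rewrite !mxE mulrC. Qed.

Lemma map_frac_mx (D E : idomainType) (h : {rmorphism D -> E}) T b :
    (forall u, h u = 0 -> u = 0) -> b != 0 ->
  map_mx (frac_map h) (frac_mx T b) = frac_mx (map_mx h T) (h b).
Proof.
move=> h_inj nzb; apply/matrixP=> i j; rewrite !mxE frac_mapE //.
exact: rmorphM.
Qed.

Lemma eq_frac_mx (D : idomainType) (T T' : 'M[D]_(n * n)) b b' :
  b != 0 -> b' != 0 -> frac_mx T b = frac_mx T' b' -> b' *: T = b *: T'.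
Proof.
move=> nzb nzb' /matrixP E; apply/matrixP=> i j; have := E i j; rewrite !mxE.
move/eqP; rewrite eqr_div ?tofrac_eq0 // -!tofracM tofrac_eq => /eqP.
by rewrite mulrC => ->; rewrite mulrC.
Qed.

Lemma frac_mx_conj (D : idomainType) (A A' B B' : 'M[D]_n) c T b
    (F := @FracField.tofrac D) r :
    c != 0 -> F c *: r = tens_conj (map_mx F A) (map_mx F A') (map_mx F B) (map_mx F B')
      (frac_mx T b) ->
  r = frac_mx (tens_conj A A' B B' T) (b * c).
Proof.
move=> nzc E; apply: (@scalerI _ _ (F c)); first by rewrite tofrac_eq0.
rewrite E !frac_mxE /F tofracM invfM scalerA mulrCA divff ?tofrac_eq0 // mulr1.
by rewrite linearZ /= /tens_conj !map_mxM !map_mxT.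
Qed.

Lemma cleared_cybe_frac (D : idomainType) (T12 T13 T23 : 'M[D]_(n * n)) b12 b13 b23 :
    b12 != 0 -> b13 != 0 -> b23 != 0 ->
  cleared_cybe (frac_mx T12 b12) (frac_mx T13 b13) (frac_mx T23 b23) 1 1 1 = 0 ->
  cleared_cybe T12 T13 T23 b12 b13 b23 = 0.
Proof.
move=> nz12 nz13 nz23; rewrite !frac_mxE.
have bVb b : b != 0 -> 1 = (b%:F)^-1 * b%:F :> {fraction D}.
  by move=> nzb; rewrite mulVf ?tofrac_eq0.
rewrite {1}(bVb _ nz12) {1}(bVb _ nz13) {1}(bVb _ nz23) cleared_cybeZ.
rewrite -map_cleared_cybe => /eqP; rewrite scaler_eq0.
rewrite !mulf_eq0 !invr_eq0 !tofrac_eq0 (negPf nz12) (negPf nz13) (negPf nz23) /=.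
move/eqP/matrixP => E; apply/matrixP=> i j; have := E i j; rewrite !mxE.
by move/eqP; rewrite tofrac_eq0 => /eqP.
Qed.

Lemma legs_cybe_frac (D E : idomainType) (h12 h13 h23 : {rmorphism D -> E}) T b :
    (forall u, h12 u = 0 -> u = 0) -> (forall u, h13 u = 0 -> u = 0) ->
    (forall u, h23 u = 0 -> u = 0) -> b != 0 ->
    let r := frac_mx T b in
    let r12 := leg12 (map_mx (frac_map h12) r) in
    let r13 := leg13 (map_mx (frac_map h13) r) in
    let r23 := leg23 (map_mx (frac_map h23) r) in
    r13 *m r12 - r12 *m r23 + r23 *m r13 = 0 ->
  legs_cybe h12 h13 h23 T b = 0.
Proof.
move=> h12_inj h13_inj h23_inj nzb /=; rewrite -cleared_cybe1 !map_frac_mx //.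
have nzh (h : {rmorphism D -> E}) : (forall u, h u = 0 -> u = 0) -> h b != 0.
  by move=> h_inj; apply: contra_neq nzb => /h_inj.
by apply: cleared_cybe_frac; apply: nzh.
Qed.

End Fractions.

(** * Transport of the equation along an equivalence *)

Section Transport.
Variables (k : fieldType) (n : nat).
Hypothesis n_gt0 : (0 < n)%N.
Local Notation x := (svar 0 : {series k[2]}).
Local Notation y := (svar 1 : {series k[2]}).
Local Notation z i := (svar i : {series k[3]}).

Lemma sord_pair (i j : 'I_3) l : sord 1 (tnth [tuple z i; z j] l).
Proof. by apply: sord_tuple2; apply: sord_svar. Qed.

Definition legvars i j : {rmorphism {series k[2]} -> {series k[3]}} :=
  ssubst_morph (sord_pair i j).

(** A left inverse is the substitution z_i |-> x, z_j |-> y that sends the third variable to 0. *)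
Lemma legvars_inj i j f : i != j -> legvars i j f = 0 -> f = 0.
Proof.
move=> neij /(congr1 (ssubst
  [tuple (if l == i then x else if l == j then y else 0) | l < 3])).
have g1 l : sord 1 (tnth [tuple (if l == i then x else if l == j then y else 0) | l < 3] l).
  by rewrite tnth_mktuple; case: ifP => // _; [|case: ifP => // _]; apply: sord_svar.
rewrite [RHS](ssubst_morphE g1) raddf0 [legvars _ _ _]/(ssubst _ f).
rewrite (@ssubst_comp _ _ _ _ _ _ [tuple x; y] _ g1 (sord_pair i j)).
  by rewrite ssubst_id // => -[[|[|]]] // ?; congr svar; apply: val_inj.
move=> [[|[|]]] // lt; rewrite [tnth [tuple z i; z j] _]/tnth /= ssubst_svar ?tnth_mktuple //.
  by rewrite (eqxx i).
by rewrite [j == i]eq_sym (negPf neij) (eqxx j).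
Qed.

Lemma legvars01_inj f : legvars 0 1 f = 0 -> f = 0.
Proof. exact: legvars_inj. Qed.
Lemma legvars02_inj f : legvars 0 2%:R f = 0 -> f = 0.
Proof. exact: legvars_inj. Qed.
Lemma legvars12_inj f : legvars 1 2%:R f = 0 -> f = 0.
Proof. exact: legvars_inj. Qed.

Definition series_cybe (T : 'M[{series k[2]}]_(n * n)) b :=
  legs_cybe (legvars 0 1) (legvars 0 2%:R) (legvars 1 2%:R) T b.

Lemma CYBE_series T b : b != 0 -> CYBE (frac_mx T b) -> series_cybe T b = 0.
Proof.
exact: (@legs_cybe_frac _ _ _ (legvars 0 1) (legvars 0 2%:R) (legvars 1 2%:R)
          T b legvars01_inj legvars02_inj legvars12_inj).
Qed.

Definition at_var d (i : 'I_d) : {rmorphism {series k[1]} -> {series k[d]}} :=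
  ssubst_morph (sord_tuple1 (sord_svar k i)).

Lemma at_var_inj d (i : 'I_d) f : at_var i f = 0 -> f = 0.
Proof.
pose t : d.-tuple {series k[1]} := [tuple svar 0 | _ < d].
have t1 l : sord 1 (tnth t l) by rewrite tnth_mktuple; apply: sord_svar.
move=> /(congr1 (ssubst t)); rewrite [RHS](ssubst_morphE t1) raddf0.
rewrite (@ssubst_comp _ _ _ _ _ _ [tuple svar 0] _ t1 (sord_tuple1 (sord_svar k i))).
  by rewrite ssubst_id // => l; rewrite [l]ord1.
by move=> l; rewrite [l]ord1 [tnth [tuple svar i] _]/tnth /= ssubst_svar ?tnth_mktuple.
Qed.

Lemma legvars_at_var0 i j f : legvars i j (at_var 0 f) = at_var i f.
Proof.
apply: ssubst_comp; [exact: sord_pair | exact/sord_tuple1/sord_svar | move=> l].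
rewrite [l]ord1 [tnth [tuple x] _]/tnth [tnth [tuple z i] _]/tnth /=.
by rewrite ssubst_svar //; apply: sord_pair.
Qed.

Lemma legvars_at_var1 i j f : legvars i j (at_var 1 f) = at_var j f.
Proof.
apply: ssubst_comp; [exact: sord_pair | exact/sord_tuple1/sord_svar | move=> l].
rewrite [l]ord1 [tnth [tuple y] _]/tnth [tnth [tuple z j] _]/tnth /=.
by rewrite ssubst_svar //; apply: sord_pair.
Qed.

Lemma svarB_neq0 : x - y != 0.
Proof.
pose m0 : 'X_{1..2} := (U_((0 : 'I_2)%R))%MM.
apply/eqP => /(congr1 (fun f : {series k[2]} => scoef f m0)) /eqP.
rewrite scoefD scoefN /= eqxx.
rewrite (_ : (m0 == U_((1 : 'I_2)%R)%MM) = false) ?subr0 ?oner_eq0 //.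
by apply/eqP => /mnmP/(_ 0); rewrite !mnm1E.
Qed.

Section Coordinate.
Variable v : {series k[1]}.
Hypothesis unit_v : v \is a GRing.unit.
Let u := svar 0 * v.

Lemma sord_coord d (i : 'I_d) : sord 1 (at_var i u).
Proof.
apply: sord_ssubst; first exact/sord_tuple1/sord_svar.
by rewrite /u mulrC; apply/sordMl/sord_svar.
Qed.

Definition coord2 : {rmorphism {series k[2]} -> {series k[2]}} :=
  ssubst_morph (sord_tuple2 (sord_coord 0) (sord_coord 1)).

Definition coord3 : {rmorphism {series k[3]} -> {series k[3]}} :=
  ssubst_morph (sord_tuple3 (sord_coord 0) (sord_coord 1) (sord_coord 2%:R)).

Lemma coord_legvars i j f : coord3 (legvars i j f) = legvars i j (coord2 f).
Proof.
pose t := [tuple at_var i u; at_var j u].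
transitivity (ssubst t f).
  apply: ssubst_comp; [|exact: sord_pair|].
    by apply: sord_tuple3; apply: sord_coord.
  have h (l : 'I_3) : at_var l u =
      ssubst [tuple at_var 0 u; at_var 1 u; at_var 2%:R u] (svar l).
    rewrite ssubst_svar; last by apply: sord_tuple3; apply: sord_coord.
    by case: l => [[|[|[|]]]] // ?; rewrite /tnth /=; congr (at_var _ _); apply: val_inj.
  by move=> [[|[|]]] // ?; rewrite /t ![tnth _ _]/tnth /= h.
apply/esym/ssubst_comp; [exact: sord_pair | by apply: sord_tuple2; apply: sord_coord |].
move=> [[|[|]]] // ?; rewrite ![tnth _ _]/tnth /=.
  exact/esym/legvars_at_var0.
exact/esym/legvars_at_var1.
Qed.

(** A unit v has nonzero constant term, so each variable is multiplied by a series with the same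
    nonzero constant term and [ssubst_inj] applies. *)
Lemma coord2_inj f : coord2 f = 0 -> f = 0.
Proof.
have nzv : scoef v 0%MM != 0.
  apply/eqP => v0; have := congr1 (fun g => scoef g 0%MM) (mulVr unit_v).
  rewrite scoef1 eqxx => /eqP; rewrite eq_sym; apply/negP.
  rewrite (_ : scoef _ _ = 0) ?oner_eq0 //.
  have v1 : sord 1 v by move=> l; rewrite ltnS leqn0 mdeg_eq0 => /eqP ->.
  by apply: (@sordMl _ _ 1 v^-1 v v1); rewrite mdeg0.
apply: (ssubst_inj (v := fun i => at_var i v) nzv) => i.
  have -> : svar i = at_var i (svar 0).
    by rewrite [RHS]ssubst_svar //; apply/sord_tuple1/sord_svar.
  rewrite -rmorphM; case: i => [[|[|]]] // ?; rewrite /tnth /=;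
    by congr (at_var _ _); apply: val_inj.
rewrite -(ssubst_const (sord_tuple1 (sord_svar k i))).
rewrite -[ssubst _ _]/(at_var i _) -rmorphB.
apply: sord_ssubst; first exact/sord_tuple1/sord_svar.
by move=> l; rewrite ltnS leqn0 mdeg_eq0 => /eqP ->; rewrite scoefD scoefN /= eqxx subrr.
Qed.

End Coordinate.

(** The coordinate change commutes with the three embeddings, and the automorphism acts as
    conjugation by G in each leg up to e. Both preserve the cleared equation of r0, whose result is
    compared with T / b only at the end. *)
Theorem equivalent_series_cybe r0 T b :
  b != 0 -> solution r0 -> equivalent r0 (frac_mx T b) -> series_cybe T b = 0.
Proof.
move=> nzb [[N [f]]]; rewrite -/(frac_mx f ((x - y) ^+ N)) => -> cybe0.
have nzxy : (x - y) ^+ N != 0 by rewrite expf_neq0 // svarB_neq0.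
have {}cybe0 := CYBE_series nzxy cybe0.
move=> [phi [v /= [aut_phi unit_v E]]].
have [G [G' [e [nze G'G GE]]]] := alg_aut_conj n_gt0 aut_phi.
have nze_at d (i : 'I_d) : at_var i e != 0 by apply: contra_neq nze => /at_var_inj.
have {}cybe0 : series_cybe (map_mx (coord2 v) f) (coord2 v ((x - y) ^+ N)) = 0.
  rewrite /series_cybe -(@map_legs_cybe _ _ _ _ _ _ (coord2 v) (coord3 v))
    ?[legs_cybe _ _ _ _ _]cybe0 ?map_mx0 //.
  - exact: coord_legvars.
  - exact: coord_legvars.
  - exact: coord_legvars.
have nzb0 : coord2 v ((x - y) ^+ N) != 0.
  by apply: contra_neq nzxy => /(coord2_inj unit_v).
have fracE := map_frac_mx f (coord2_inj unit_v) nzxy.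
rewrite -[map_mx _ _]/(map_mx (frac_map (coord2 v)) (frac_mx f ((x - y) ^+ N))) fracE in E.
move: (coord2 v ((x - y) ^+ N)) nzb0 cybe0 E {fracE} => b0 nzb0 cybe0 E.
have cybe' := legs_cybe_conj (legvars_at_var0 0 1) (legvars_at_var1 0 1)
  (legvars_at_var0 0 2%:R) (legvars_at_var1 0 2%:R)
  (legvars_at_var0 1 2%:R) (legvars_at_var1 1 2%:R) G'G cybe0.
have nzc : at_var (0 : 'I_2) e * at_var (1 : 'I_2) e != 0 by rewrite mulf_neq0 ?nze_at.
have nzb' : b0 * (at_var (0 : 'I_2) e * at_var (1 : 'I_2) e) != 0 by rewrite mulf_neq0.
(* It remains to see that T / b and the conjugated pair are the same fraction, which is the
   equivalence itself multiplied by e(x) e(y). *)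
refine (legs_cybe_eq legvars01_inj legvars02_inj legvars12_inj nzb' _ cybe').
apply: (eq_frac_mx nzb nzb'); apply: (frac_mx_conj nzc).
have autE (i : 'I_2) p q : (at_var i e)%:F *: aut_at phi (svar i) (delta_mx p q)
   = map_mx (@FracField.tofrac _) (map_mx (at_var i) G) *m delta_mx p q *m
     map_mx (@FracField.tofrac _) (map_mx (at_var i) G').
  rewrite /aut_at map_delta_mx.
  have := congr1 (map_mx (@FracField.tofrac _ \o at_var i)) (GE p q).
  by rewrite map_mxZ !map_mxM map_delta_mx -!map_mx_comp.
rewrite -E tofracM -(tens_lift_conj _ (autE 0) (autE 1)).
by [].
Qed.

End Transport.

(** * The standard forms *)

Section FracTrig.
Variables (k : comNzRingType) (D : idomainType) (iota : {rmorphism k -> D}).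
Variables (n m : nat) (gamma : 'I_m -> 'M[k]_(n * n)).
Variables (X Y : D).
Hypotheses (nzX : X != 0) (nzY : Y != 0) (nzXY : X ^+ m - Y ^+ m != 0).
Local Notation F := (@FracField.tofrac D).

Definition poly_mx (S : 'M[{mpoly k[2]}]_(n * n)) : 'M[{fraction D}]_(n * n) :=
  map_mx F (map_mx (mmap iota (tnth [tuple X; Y])) S).

Lemma frac_trig_form (c : 'I_m -> {fraction D}) M S L :
    (forall j : 'I_m, c j * F (X ^+ m - Y ^+ m) = F (X ^+ j * Y ^+ (m - j))) ->
    F ((X * Y) ^+ M) *: L = poly_mx S ->
  \sum_j c j *: map_mx (F \o iota) (gamma j) + L
  = frac_mx (trig_num M gamma S iota X Y) (trig_den m M X Y).
Proof.
move=> cE LE; have nzd : trig_den m M X Y != 0.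
  by rewrite mulf_neq0 // expf_neq0 ?mulf_neq0.
rewrite frac_mxE; apply: (@scalerI _ _ (F (trig_den m M X Y))); first by rewrite tofrac_eq0.
rewrite scalerA divff ?tofrac_eq0 // scale1r scalerDr /trig_num map_mxD !map_mxZ.
rewrite [in X in X + _]/trig_den [in X in _ + X]/trig_den -/(poly_mx S) -LE.
rewrite !tofracM scalerA; congr (_ + _).
rewrite mulrC -scalerA; congr (_ *: _).
rewrite [in RHS]raddf_sum scaler_sumr; apply: eq_bigr => j _.
by rewrite /= map_mxZ scalerA mulrC cE -map_mx_comp.
Qed.

(** L is a Laurent polynomial in X and Y. Quantifying over all large M lets a sum use one exponent
    for its terms. *)
Definition laurent_mx (L : 'M[{fraction D}]_(n * n)) :=
  exists M0, forall M, (M0 <= M)%N -> exists S, F ((X * Y) ^+ M) *: L = poly_mx S.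

Lemma laurent_mxD L L' : laurent_mx L -> laurent_mx L' -> laurent_mx (L + L').
Proof.
move=> [M0 LM] [M0' LM']; exists (maxn M0 M0') => M; rewrite geq_max.
case/andP=> /LM [S ES] /LM' [S' ES']; exists (S + S').
by rewrite scalerDr ES ES' /poly_mx !map_mxD.
Qed.

Lemma laurent_mx0 : laurent_mx 0.
Proof. by exists 0 => M _; exists 0; rewrite scaler0 /poly_mx !map_mx0. Qed.

Lemma laurent_mx_sum I (r : seq I) (P : pred I) (L : I -> _) :
  (forall i, P i -> laurent_mx (L i)) -> laurent_mx (\sum_(i <- r | P i) L i).
Proof.
move=> LP; apply: (big_ind laurent_mx) => //; [exact: laurent_mx0 | exact: laurent_mxD].
Qed.

Lemma expr_shift (K : fieldType) (w : K) (i : int) M : w != 0 ->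
  (`|i| <= M)%N -> exists a : nat, w ^+ M * w ^ i = w ^+ a.
Proof.
move=> nzw; case: i => a leaM; first by exists (M + a)%N; rewrite exprD.
(* [Negz a] stands for -(a + 1). *)
exists (M - a.+1)%N; rewrite -[w ^ Negz a]/(w ^+ a.+1)^-1.
by rewrite -[in LHS](subnK leaM) exprD mulfK ?expf_neq0.
Qed.

Lemma laurent_mx_monomial (i j : int) (C : 'M[k]_(n * n)) :
  laurent_mx ((F X ^ i * F Y ^ j) *: map_mx (F \o iota) C).
Proof.
exists (maxn `|i| `|j|) => M; rewrite geq_max => /andP[lei lej].
have nzFX : F X != 0 by rewrite tofrac_eq0.
have nzFY : F Y != 0 by rewrite tofrac_eq0.
have [a Ea] := expr_shift nzFX lei; have [b Eb] := expr_shift nzFY lej.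
exists (map_mx (fun c => c%:MP * ('X_0 ^+ a * 'X_1 ^+ b)) C).
rewrite scalerA exprMn tofracM !tofracXn mulrACA Ea Eb.
apply/matrixP=> p q; rewrite !mxE !rmorphM !rmorphXn /= mmapC !mmapX !mmap1U.
by rewrite [LHS]mulrC.
Qed.

Lemma laurent_mx_tens (r r' : seq int) (a b : int -> 'M[k]_n) :
  laurent_mx ((\sum_(i <- r) F X ^ i *: map_mx (F \o iota) (a i)) *t
              (\sum_(j <- r') F Y ^ j *: map_mx (F \o iota) (b j))).
Proof.
have tDl (u : 'M[{fraction D}]_n) : {morph (fun v : 'M_n => v *t u) : v w / v + w}.
  by move=> v w; rewrite -[v]scale1r tensmx_linearl !scale1r.
have tDr (u : 'M[{fraction D}]_n) : {morph (fun v : 'M_n => u *t v) : v w / v + w}.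
  by move=> v w; rewrite -[v]scale1r tensmx_linearr !scale1r.
rewrite (big_morph _ (tDl _) (tens0mx _)); apply: laurent_mx_sum => i _.
rewrite (big_morph _ (tDr _) (tensmx0 _)); apply: laurent_mx_sum => j _.
rewrite tensmxZl tensmxZr scalerA -map_mxT.
exact: laurent_mx_monomial.
Qed.

End FracTrig.

Lemma frac_coef (D : idomainType) (e q u v : D) : e != 0 -> q * u = v ->
  e%:F^-1 * q%:F * (e * u)%:F = v%:F.
Proof.
move=> nze <-; rewrite !tofracM mulrACA mulVf ?tofrac_eq0 //.
by rewrite mul1r.
Qed.

Lemma scale_sum (K : comNzRingType) n m (d : K) (q : 'I_m -> K) (G : 'I_m -> 'M[K]_n) :
  d *: (\sum_j q j *: G j) = \sum_j (d * q j) *: G j.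
Proof. by rewrite scaler_sumr; apply: eq_bigr => j _; rewrite scalerA. Qed.

Section Final.
Variables (k : fieldType) (n : nat).
Hypotheses (char0 : [pchar k] =i pred0) (n_gt0 : (0 < n)%N).

Section SeriesAt.
Variables (c0 : k) (w v : {series k[1]}).
Hypotheses (nzv : scoef v 0%MM != 0) (wE : w = sconst c0 + svar 0 * v).

Definition series_at d (p : {mpoly k[d]}) : {series k[d]} :=
  mmap sconst (fun i => at_var k i w) p.

Lemma at_var_const d (i : 'I_d) (c : k) : at_var k i (sconst c) = sconst c.
Proof. exact/ssubst_const/sord_tuple1/sord_svar. Qed.

Lemma at_var_svar d (i : 'I_d) : at_var k i (svar 0) = svar i.
Proof. by rewrite [LHS]ssubst_svar //; apply/sord_tuple1/sord_svar. Qed.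

(** Translating p by c0 removes the constant term of w; what remains is the substitution z_i |-> z_i
    v(z_i) with v(0) != 0, covered by [ssubst_inj]. *)
Lemma series_at_inj d (p : {mpoly k[d]}) : series_at p = 0 -> p = 0.
Proof.
pose g := [tuple svar i * at_var k i v | i < d].
have g1 i : sord 1 (tnth g i).
  by rewrite tnth_mktuple mulrC; apply/sordMl/sord_svar.
pose q := p \mPo [tuple 'X_i + c0%:MP | i < d].
have -> : series_at p = ssubst g (series_of_mpoly q).
  rewrite (ssubst_poly g1) /q [RHS]rmorph_mmap; apply: eq_mmap => [c|i] /=.
    by rewrite spevalC.
  rewrite tnth_mktuple rmorphD /= spevalC spevalX tnth_mktuple wE rmorphD rmorphM.
  by rewrite /= at_var_const at_var_svar addrC.
have vc (i : 'I_d) : sord 1 (at_var k i v - sconst (scoef v 0%MM)).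
  rewrite -(at_var_const i) -rmorphB; apply: sord_ssubst; first exact/sord_tuple1/sord_svar.
  by move=> l; rewrite ltnS leqn0 mdeg_eq0 => /eqP ->; rewrite scoefD scoefN /= eqxx subrr.
have gE (i : 'I_d) : tnth g i = svar i * at_var k i v by rewrite tnth_mktuple.
move/(ssubst_inj nzv gE vc)/series_of_mpoly_inj => q0.
have <- : q \mPo [tuple 'X_i - c0%:MP | i < d] = p.
  rewrite /q [LHS]rmorph_mmap -[RHS]comp_mpoly_id; apply: eq_mmap => [c|i] /=.
    by rewrite comp_mpolyC.
  rewrite !tnth_mktuple comp_mpolyD comp_mpolyC comp_mpolyXU -tnth_nth tnth_mktuple.
  by rewrite subrK.
by rewrite q0 comp_mpoly0.
Qed.

Lemma series_atX d (i : 'I_d) : series_at 'X_i = at_var k i w.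
Proof. by rewrite /series_at mmapX mmap1U. Qed.

Local Notation X := (at_var k (0 : 'I_2) w).
Local Notation Y := (at_var k (1 : 'I_2) w).
Local Notation X_ i := ('X_i : {mpoly k[2]}).

Let meval2 (a b : k) (p : {mpoly k[2]}) : k := p.@[tnth [tuple a; b]].

(** Nonvanishing of a denominator in series is thus checked at a single point of k^2. *)
Lemma series_at_neq0 (p : {mpoly k[2]}) a b : meval2 a b p != 0 -> series_at p != 0.
Proof.
by apply: contra_neq => /series_at_inj ->; rewrite /meval2 meval0.
Qed.

Lemma at_w0_neq0 : X != 0.
Proof.
rewrite -series_atX; apply: (@series_at_neq0 _ 1 1).
by rewrite /meval2 mevalXU oner_eq0.
Qed.

Lemma at_w1_neq0 : Y != 0.
Proof.
rewrite -series_atX; apply: (@series_at_neq0 _ 1 1).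
by rewrite /meval2 mevalXU oner_eq0.
Qed.

Lemma at_wB_neq0 m : (0 < m)%N -> X ^+ m - Y ^+ m != 0.
Proof.
move=> m_gt0; rewrite -!series_atX /series_at -!rmorphXn -rmorphB.
apply: (@series_at_neq0 _ 1 0); rewrite /meval2 mevalB !rmorphXn /= !mevalXU.
by rewrite /tnth /= expr1n expr0n gtn_eqF // subr0 oner_eq0.
Qed.

(** The series identity is the image of the polynomial one under X_i |-> w(z_i), and this map is
    injective, so the polynomial A-CYBE would hold. *)
Lemma no_series_trig m M (gamma : 'I_m -> 'M[k]_(n * n)) S :
    (0 < m)%N -> casimir k n = \sum_j gamma j ->
  series_cybe (trig_num M gamma S sconst X Y) (trig_den m M X Y) <> 0.
Proof.
move=> m_gt0 sum_gamma cybe.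
apply: (@no_trig_cybe k n m M gamma S char0 n_gt0 m_gt0 sum_gamma).
pose h : {rmorphism {mpoly k[3]} -> {series k[3]}} := mmap sconst (fun i => at_var k i w).
suff E : map_mx h (trig_cybe M gamma S (fun c => c%:MP) 'X_0 'X_1 'X_2%:R) = 0.
  apply/matrixP=> i j; rewrite [RHS]mxE; apply: series_at_inj.
  by have /matrixP/(_ i j) := E; rewrite mxE [RHS]mxE.
have hC (c : k) : h c%:MP = sconst c by apply: mmapC.
have hX (i : 'I_3) : h 'X_i = at_var k i w by apply: series_atX.
rewrite (map_trig_cybe _ _ _ _ _ _ hC) (hX 0) (hX 1) (hX 2%:R) -[RHS]cybe.
have lC i j (c : k) : legvars k i j (sconst c) = sconst c.
  exact/ssubst_const/sord_pair.
rewrite /series_cybe /legs_cybe /trig_cybe !rmorph_trig_den.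
rewrite !(map_trig_num _ _ _ _ _ (lC _ _)).
rewrite (legvars_at_var0 0 1) (legvars_at_var1 0 1) (legvars_at_var0 0 2%:R).
by rewrite (legvars_at_var1 0 2%:R) (legvars_at_var0 1 2%:R) (legvars_at_var1 1 2%:R).
Qed.

Lemma no_trig_form r m M (gamma : 'I_m -> 'M[k]_(n * n)) c L S :
    (0 < m)%N -> casimir k n = \sum_j gamma j ->
    (forall j : 'I_m, c j * (X ^+ m - Y ^+ m)%:F = (X ^+ j * Y ^+ (m - j))%:F) ->
    ((X * Y) ^+ M)%:F *: L = poly_mx sconst X Y S ->
    solution r ->
  ~ equivalent r (\sum_j c j *: map_mx (@sfconst k 2) (gamma j) + L).
Proof.
move=> m_gt0 sum_gamma cE LE sol_r.
have := @frac_trig_form k _ sconst n m gamma X Y at_w0_neq0 at_w1_neq0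
  (at_wB_neq0 m_gt0) c M S L cE LE.
rewrite -[map_mx (_ \o _)]/(map_mx (@sfconst k 2)) => ->.
move=> eqv; apply: (no_series_trig m_gt0 sum_gamma).
apply: (equivalent_series_cybe n_gt0 _ sol_r eqv).
by rewrite mulf_neq0 ?expf_neq0 ?mulf_neq0 ?at_wB_neq0 ?at_w0_neq0 ?at_w1_neq0.
Qed.

End SeriesAt.

Lemma no_quasi_trigonometric (r : 'M[{sfrac k[2]}]_(n * n)) : ~ quasi_trigonometric r.
Proof.
move=> [sol_r [t eqv]]; pose w : {series k[1]} := svar 0.
have wE : w = sconst 0 + svar 0 * 1 by rewrite rmorph0 add0r mulr1.
have nz1 : scoef (1 : {series k[1]}) 0%MM != 0 by rewrite scoef1 eqxx oner_eq0.
have X2 (i : 'I_2) : at_var k i w = svar i by apply: at_var_svar.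
have nzxy := svarB_neq0 k.
(* The case m = 1, M = 0: no change of coordinates, one residue tensor, and a regular part that is
   already polynomial. *)
pose c (_ : 'I_1) : {sfrac k[2]} := (svar 1)%:F / (svar 0 - svar 1)%:F.
have cE (j : 'I_1) : c j * (at_var k (0 : 'I_2) w ^+ 1 - at_var k (1 : 'I_2) w ^+ 1)%:F
    = (at_var k (0 : 'I_2) w ^+ j * at_var k (1 : 'I_2) w ^+ (1 - j))%:F.
  by rewrite [j]ord1 !X2 mul1r subn0 expr1 /c divfK // tofrac_eq0.
pose L := map_mx (fun p => (series_of_mpoly p)%:F) t : 'M[{sfrac k[2]}]_(n * n).
have LE : ((at_var k (0 : 'I_2) w * at_var k (1 : 'I_2) w) ^+ 0)%:F *: L
    = poly_mx sconst (at_var k (0 : 'I_2) w) (at_var k (1 : 'I_2) w) t.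
  apply/matrixP=> i j; rewrite expr0 tofrac1 !mxE mul1r; congr (_%:F).
  by apply: series_of_mpolyE => -[[|[|]]] // ?;
    rewrite /tnth /= X2; congr svar; apply: val_inj.
apply: (@no_trig_form 0 w 1 nz1 wE r 1 0 (fun=> casimir k n) c L t _ _ cE LE sol_r) => //.
  by rewrite big_ord1.
by rewrite big_ord1.
Qed.

Lemma no_trigonometric (r : 'M[{sfrac k[2]}]_(n * n)) : ~ trigonometric r.
Proof.
move=> [sol_r [sigma [m [eps [gamma [s [[_ _ [m_gt0 _ _] _] [sum_gamma _ _ /= eqv]]]]]]]].
pose c : k := 1 / m%:R; pose g : {series k[1]} := sconst c * svar 0.
have g1 : sord 1 g by apply/sordMl/sord_svar.
pose a (j : nat) : k := (j`!%:R)^-1; pose w := sexp g.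
(* Here w = exp(z / m) = 1 + z v, and v has constant term 1 / m. *)
pose v := sconst c * spow (fun j => a j.+1) g.
have wE : w = sconst (a 0) + svar 0 * v.
  by rewrite /w sexpE spow_shift // /v mulrCA mulrA.
have nzm : m%:R != 0 :> k by move/pcharf0P: char0 => ->; rewrite -lt0n.
have nzv : scoef v 0%MM != 0.
  rewrite scoef_sconstM mulf_neq0 //; first by rewrite /c mul1r invr_eq0.
  rewrite scoef_spow mdeg0 big_ord1 expr0 scoef1 eqxx mul1r invr_eq0.
  exact: fact_neq0.
have X2 (i : 'I_2) : at_var k i w = sexp (sconst c * svar i).
  rewrite [LHS](@ssubst_spow _ _ _ _ a g (sord_tuple1 (sord_svar k i)) g1).
  by rewrite -[ssubst _ _]/(at_var k i _) rmorphM /= at_var_const at_var_svar.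
set X := at_var k (0 : 'I_2) w; set Y := at_var k (1 : 'I_2) w.
pose x : {series k[2]} := svar 0; pose y : {series k[2]} := svar 1.
have XE : X = sexp (sconst c * x) := X2 0.
have YE : Y = sexp (sconst c * y) := X2 1.
have x1 : sord 1 (sconst c * x) by apply/sordMl/sord_svar.
have y1 : sord 1 (sconst c * y) by apply/sordMl/sord_svar.
(* With X = exp(x / m) and Y = exp(y / m), the coefficient exp(j (x - y) / m) is (X / Y)^j; the case
   j = m rewrites exp(x - y) - 1 as (X^m - Y^m) / Y^m. *)
have expE (j : nat) : sexp (sconst (j%:R / m%:R) * (x - y)) * Y ^+ j = X ^+ j.
  have nxy1 : sord 1 (sconst (j%:R / m%:R) * (x - y)).
    by apply/sordMl/sordD/sordN/sord_svar/sord_svar.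
  have ny1 : sord 1 ((sconst c * y) *+ j) by rewrite -mulr_natl; apply: sordMl.
  rewrite XE YE -(sexpMn char0 j y1) -(sexpMn char0 j x1) -(sexpD char0 nxy1 ny1).
  congr sexp.
  have -> : j%:R / m%:R = c *+ j by rewrite /c mul1r mulr_natl.
  by rewrite rmorphMn /= -!mulrnAl mulrBr subrK.
have expmE : (sexp (x - y) - 1) * Y ^+ m = X ^+ m - Y ^+ m.
  have := expE m; rewrite (divff nzm) (rmorph1 (@sconst 2 k)) mul1r => <-.
  by rewrite mulrBl mul1r.
have nzXY : X ^+ m - Y ^+ m != 0 by apply: (at_wB_neq0 nzv wE m_gt0).
have nze : sexp (x - y) - 1 != 0.
  by apply: contra_neq nzXY => e0; rewrite -expmE e0 mul0r.
pose q j := sexp (sconst (j%:R / m%:R) * (x - y)).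
pose cc (j : 'I_m) : {sfrac k[2]} := (sexp (x - y) - 1)%:F^-1 * (q j)%:F.
have cE (j : 'I_m) : cc j * (X ^+ m - Y ^+ m)%:F = (X ^+ j * Y ^+ (m - j))%:F.
  rewrite -expmE /cc; apply: frac_coef nze _; rewrite -/(q j).
  by rewrite -(expE j) -mulrA -exprD subnKC // ltnW.
pose L : 'M[{sfrac k[2]}]_(n * n) := \sum_(p <- s) laurent_at X%:F p.1 *t laurent_at Y%:F p.2.
have [M0 LM] : laurent_mx sconst X Y L.
  apply: laurent_mx_sum => p _.
  exact: (laurent_mx_tens sconst (at_w0_neq0 nzv wE) (at_w1_neq0 nzv wE)).
have [S LE] := LM _ (leqnn M0).
apply: (@no_trig_form (a 0%N) w v nzv wE r m M0 gamma cc L S m_gt0 sum_gamma cE LE sol_r).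
by move: eqv; rewrite scale_sum -XE -YE.
Qed.

End Final.

Theorem theorem7p5 (k : closedFieldType) (char0 : [pchar k] =i pred0)
    (n : nat) (n_gt0 : (0 < n)%N) :
  ~ (exists r : 'M[{sfrac k[2]}]_(n * n), quasi_trigonometric r) /\
  ~ (exists r : 'M[{sfrac k[2]}]_(n * n), trigonometric r).
Proof.
split=> -[r]; first exact: no_quasi_trigonometric.
exact: no_trigonometric.
Qed.
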